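(* Let $\Omega\subset\mathbb{R}^2$ be an analytic non-convex domain. Let $x\in cl(\Omega)$ and let $v\in\mathbb{V}^N$ be nonzero. Let $(x^i,v^i)=(x^i(x,v),v^i(x,v))$ be the (backward) specular cycle of $(x,v)$. If $(x^i(x,v),v^i(x,v))\notin\gamma_0^I$ for all $i=0,1,2,\dots$, then $$\sum_{i=0}^\infty|x^i(x,v)-x^{i+1}(x,v)|=\infty .$$
   Context: Analytic non-convex domain: $\Omega\subset\mathbb{R}^2$ is an open connected bounded set for which there are simply connected subsets $\Omega_i\subset\mathbb{R}^2$, $i=0,1,\dots,M<\infty$, with $\Omega=\Omega_0\setminus\{\Omega_1\cup\dots\cup\Omega_M\}$, such that: (1) $\Omega_i\subset\subset\Omega_0$ for $i=1,\dots,M$ and $\partial\Omega_i\cap\partial\Omega_j=\emptyset$ for all $i\ne j$; (2) each $\partial\Omega_i$ is the image of a closed regular analytic curve $\alpha_i:[a_i,b_i]\to\mathbb{R}^2$; (3) $\partial\Omega=\bigsqcup_{i=0}^M\partial\Omega_i$. $cl$ denotes closure; points are $x=(x_1,x_3)$, velocities $v=(v_1,v_3)\in\mathbb{R}^2$; $\mathbf{n}$ is the outward unit normal. $\mathbb{V}^N=\{v\in\mathbb{R}^2:\frac2N\le|v|\le\frac N2\}$ for fixed $N\gg1$. Specular cycles: $t_{\mathbf b}(x,v)=\sup\{s\ge0:\ x-\tau v\in\Omega\ \text{for all }\tau\in(0,s)\}$. Set $(t^0,x^0,v^0)=(t,x,v)$ and, when $t_{\mathbf b}>0$, inductively $t^k=t^{k-1}-t_{\mathbf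 b}(x^{k-1},v^{k-1})$, $x^k=x^{k-1}-t_{\mathbf b}(x^{k-1},v^{k-1})v^{k-1}$, $v^k=v^{k-1}-2(\mathbf{n}(x^k)\cdot v^{k-1})\mathbf{n}(x^k)$. Inflection grazing set: parametrize each $\alpha_i$ by arc length so that $\mathbf{n}(\alpha_i(\tau))=(\dot\alpha_{i,3}(\tau),-\dot\alpha_{i,1}(\tau))$ is the outward normal, and let $\kappa=\ddot\alpha_i\cdot\mathbf{n}(\alpha_i)$ be the signed curvature ($\kappa<0$ convex, $\kappa>0$ concave). The closure of $\{\tau\in[a_i,b_i]:\kappa(\tau)>0\}$ is a finite disjoint union of closed intervals $[a_{i,j},b_{i,j}]$, $j=1,\dots,N_i$. Then $\partial\Omega^I=\bigsqcup_{i=0}^M\bigsqcup_{j=1}^{N_i}\{\alpha_i(a_{i,j}),\alpha_i(b_{i,j})\}$ (inflection boundary). $\gamma_0=\{(x,v):x\in\partial\Omega,\ \mathbf{n}(x)\cdot v=0\}$ and $\gamma_0^I=\{(x,v)\in\gamma_0:x\in\partial\Omega^I\}$. *)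

(* Defs.v *)
(* Points (x_1, x_3) and velocities (v_1, v_3) of the plane
   are pairs in R * R.  The library norm on R * R is the sup norm (it gives the
   right topology), so the Euclidean norm is defined separately below. *)
From HB Require Import structures.
From mathcomp Require Import all_boot all_order all_algebra.
From mathcomp Require Import all_classical all_reals all_analysis.

Set Implicit Arguments.
Unset Strict Implicit.
Unset Printing Implicit Defensive.

Import Order.TTheory GRing.Theory Num.Theory.
Import numFieldNormedType.Exports.

Local Open Scope classical_set_scope.
Local Open Scope ring_scope.

Section Plane.
Context {R : realType}.
Implicit Types (u v x p n : R * R) (A : set (R * R)).

Definition dot u v : R := u.1 * v.1 + u.2 * v.2.
Definition enorm u : R := Num.sqrt (dot u u).

Definition velocity_shell (N : R) v := 2 / N <= enorm v <= N / 2.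

Definition boundary A : set (R * R) := closure A `\` interior A.

Definition path_in A (g : R -> R * R) :=
  {within `[0, 1], continuous g} /\ (forall t, t \in `[0, 1] -> A (g t)).

Definition path_connected A :=
  A !=set0 /\
  forall p q, A p -> A q -> exists g, [/\ path_in A g, g 0 = p & g 1 = q].

(* Every loop in A contracts in A to its base point, the base point being fixed
   during the homotopy. *)
Definition loops_contractible A :=
  forall g, path_in A g -> g 0 = g 1 ->
  exists H : R * R -> R * R,
    [/\ {within `[0, 1] `*` `[0, 1], continuous H},
        forall s t, s \in `[0, 1] -> t \in `[0, 1] -> A (H (s, t)),
        forall t, t \in `[0, 1] -> H (0, t) = g t /\ H (1, t) = g 0 &
        forall s, s \in `[0, 1] -> H (s, 0) = g 0 /\ H (s, 1) = g 0].

Definition simply_connected A := path_connected A /\ loops_contractible A.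

Definition real_analytic (f : R -> R) :=
  forall t0, exists (c : nat -> R) (r : R), 0 < r /\
    forall t, `|t - t0| < r -> pseries c (t - t0) @ \oo --> f t.

Definition curve_velocity (alpha : R -> R * R) (t : R) : R * R :=
  (derive1 (fun s => (alpha s).1) t, derive1 (fun s => (alpha s).2) t).

Definition curve_acceleration (alpha : R -> R * R) (t : R) : R * R :=
  (derive1n 2 (fun s => (alpha s).1) t, derive1n 2 (fun s => (alpha s).2) t).

Definition curve_normal (alpha : R -> R * R) (t : R) : R * R :=
  ((curve_velocity alpha t).2, - (curve_velocity alpha t).1).

(* kappa < 0 where the domain is convex and kappa > 0 where it is concave, for
   an arc-length parametrization whose curve_normal points outward. *)
Definition curvature (alpha : R -> R * R) (t : R) : R :=
  dot (curve_acceleration alpha t) (curve_normal alpha t).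

(* A closed analytic curve [a, b] -> R^2, i.e. one that closes up with all its
   derivatives, is represented by its (b - a)-periodic extension to R.  The
   curve need not be simple. *)
Definition closed_regular_analytic_curve (a b : R) (alpha : R -> R * R) :=
  [/\ a < b,
      periodic alpha (b - a),
      real_analytic (fun t => (alpha t).1) /\
      real_analytic (fun t => (alpha t).2) &
      forall t, curve_velocity alpha t != 0].

(* n is the outward unit normal of Omega at p: near p, Omega is asymptotic to
   the half-plane {y | n . (y - p) < 0}.  There is at most one such n. *)
Definition is_outward_normal (Omega : set (R * R)) p n :=
  enorm n = 1 /\
  forall eps : R, 0 < eps -> \forall y \near p,
    (eps * enorm (y - p) < - dot n (y - p) -> Omega y) /\
    (eps * enorm (y - p) < dot n (y - p) -> ~ Omega y).

Definition outward_normal (Omega : set (R * R)) p : R * R :=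
  get (is_outward_normal Omega p).

Record analytic_nonconvex_domain (Omega : set (R * R)) (M : nat)
    (Om : 'I_M.+1 -> set (R * R)) (a b : 'I_M.+1 -> R)
    (alpha : 'I_M.+1 -> R -> R * R) : Prop := AnalyticNonconvexDomain {
  domain_open : open Omega ;
  domain_connected : connected Omega ;
  domain_bounded : bounded_set Omega ;
  pieces_simply_connected : forall i, simply_connected (Om i) ;
  domain_pieces :
    Omega = Om ord0 `\` \bigcup_(i in [set i | i != ord0]) Om i ;
  holes_compactly_included : forall i, i != ord0 ->
    compact (closure (Om i)) /\ closure (Om i) `<=` Om ord0 ;
  boundaries_disjoint : forall i j, i != j ->
    boundary (Om i) `&` boundary (Om j) = set0 ;
  boundaries_curves : forall i,
    closed_regular_analytic_curve (a i) (b i) (alpha i) /\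
    boundary (Om i) = alpha i @` `[a i, b i] ;
  domain_boundary : boundary Omega = \bigcup_i boundary (Om i)
}.

(* The curves are parametrized by arc length, with the orientation for which
   curve_normal is the outward normal of Omega (not of the pieces Om i). *)
Definition arclength_outward (Omega : set (R * R)) (M : nat)
    (a b : 'I_M.+1 -> R) (alpha : 'I_M.+1 -> R -> R * R) :=
  forall i t, t \in `[a i, b i] ->
    enorm (curve_velocity (alpha i) t) = 1 /\
    is_outward_normal Omega (alpha i t) (curve_normal (alpha i) t).

(* The closure of {kappa > 0} in [a, b] is the disjoint union of the K closed
   intervals [l j, r j]; these are its connected components, so they are
   determined up to reindexing. *)
Definition concave_intervals (a b : R) (alpha : R -> R * R) (K : nat)
    (l r : 'I_K -> R) :=
  [/\ forall j, l j <= r j,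
      forall j k, j != k -> `[l j, r j] `&` `[l k, r k] = set0 &
      closure [set t | t \in `[a, b] /\ 0 < curvature alpha t] =
      \bigcup_j `[l j, r j]%classic].

Definition inflection_boundary (M : nat) (a b : 'I_M.+1 -> R)
    (alpha : 'I_M.+1 -> R -> R * R) : set (R * R) :=
  [set p | exists (i : 'I_M.+1) (K : nat) (l r : 'I_K -> R) (j : 'I_K),
    concave_intervals (a i) (b i) (alpha i) l r /\
    (p = alpha i (l j) \/ p = alpha i (r j))].

Definition grazing_set (Omega : set (R * R)) : set ((R * R) * (R * R)) :=
  [set z | boundary Omega z.1 /\ dot (outward_normal Omega z.1) z.2 = 0].

Definition inflection_grazing_set (Omega : set (R * R)) (M : nat)
    (a b : 'I_M.+1 -> R) (alpha : 'I_M.+1 -> R -> R * R) :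
    set ((R * R) * (R * R)) :=
  [set z | grazing_set Omega z /\ inflection_boundary a b alpha z.1].

Definition exit_time (Omega : set (R * R)) x v : R :=
  sup [set s | 0 <= s /\ forall tau, 0 < tau < s -> Omega (x - tau *: v)].

Definition specular_reflection n v : R * R := v - (2 * dot n v) *: n.

Definition specular_step (Omega : set (R * R)) (z : (R * R) * (R * R)) :
    (R * R) * (R * R) :=
  let x' := z.1 - exit_time Omega z.1 z.2 *: z.2 in
  (x', specular_reflection (outward_normal Omega x') z.2).

(* The pair (x^k, v^k); the times t^k do not enter the recursion.  The cycle of
   (x, v) is only meaningful when 0 < exit_time Omega x v: started tangentially
   from a point of strict convexity, this recursion stays there forever. *)
Definition specular_cycle (Omega : set (R * R)) x v (k : nat) :
    (R * R) * (R * R) :=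
  iter k (specular_step Omega) (x, v).

End Plane.

(* Main.v *)
(** A cycle of finite length converges to a boundary point [p], and near [p] it
    bounces monotonically along one analytic arc. By analyticity the curvature
    of that arc is monotone on the side of [p] where the bounces lie. If the
    curvature decreases along the motion (counted positive where the domain is
    convex), comparing two consecutive chords at their common bounce shows that
    the parameter gaps between bounces do not decrease. If it increases, the
    bounce angles do not decrease and eventually are positive, while the tangent
    turns by the sum of two bounce angles from one bounce to the next. Both
    contradict convergence. That the cycle never stops is where the inflection
    points come in: a grazing ray that reaches the boundary from inside leaves
    [Omega] only where the curvature changes sign. *)
Require Import Defs.
From HB Require Import structures.
From mathcomp Require Import all_boot all_order all_algebra.
From mathcomp Require Import all_classical all_reals all_analysis.
From mathcomp Require Import ring lra.

Set Implicit Arguments.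
Unset Strict Implicit.
Unset Printing Implicit Defensive.

Import Order.TTheory GRing.Theory Num.Theory.
Import numFieldNormedType.Exports.

Local Open Scope classical_set_scope.
Local Open Scope ring_scope.
(** * Real analytic functions *)

(** The boundary curves need not be simple, and [Omega] is tied to them pointwise only by the
    asymptotic condition of [is_outward_normal]. A main obstacle is therefore to show that near a
    boundary point [Omega] is exactly one side of a single arc ([local_chart]). In orthonormal
    coordinates at that point the arc is nearly horizontal, so tangents and chords can be described
    by angles [psi] and [chi i] of absolute value at most 1/4. All differences of angles then stay
    where sine is increasing, and the reflection law becomes linear:
    [chi i + chi i.+1 = 2 * psi (s i.+1)]. The curvature is [psi' = Y'' / X'], a quotient of
    analytic functions; its monotonicity is obtained from the sign of one analytic function, without
    showing that quotients are analytic. No expansion of the billiard map is used either: heights of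
    the arc over its chords are compared at points symmetric about a common bounce, or about the
    middle of a chord. *)

Definition geometrically_bounded {R : realType} (c : nat -> R) (A : R) :=
  0 < A /\ exists B, forall n, `|c n| <= B * A ^+ n.

Lemma pseries_cvg_bounded {R : realType} (c : nat -> R) (K : R) :
  0 < K -> cvgn (pseries c K) -> geometrically_bounded c K^-1.
Proof.
move=> K0 /cvg_series_bounded[M [_ hM]]; split; first by rewrite invr_gt0.
exists (M + 1) => n; rewrite exprVn ler_pdivlMr ?exprn_gt0//.
have := hM (M + 1) (ltr_pwDr ltr01 (lexx _)) n I.
by rewrite /= normrM (ger0_norm (exprn_ge0 _ (ltW K0))).
Qed.

Lemma pseries_bounded_cvg {R : realType} (c : nat -> R) (A z : R) :
  geometrically_bounded c A -> `|z| * A < 1 -> cvgn (pseries c z).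
Proof.
move=> [A0 [B hB]] zA; apply: normed_cvg.
have B0 : 0 <= B by have := hB 0%N; rewrite expr0 mulr1; apply: le_trans.
apply: (@series_le_cvg _ _ (geometric B (`|z| * A))) => [n|n|n|].
- exact: normr_ge0.
- by rewrite /geometric /= mulr_ge0// exprn_ge0// mulr_ge0// ltW.
- rewrite /geometric /= normrM normrX exprMn.
  have -> : B * (`|z| ^+ n * A ^+ n) = B * A ^+ n * `|z| ^+ n by ring.
  by rewrite ler_wpM2r ?exprn_ge0.
- apply: is_cvg_geometric_series.
  by rewrite ger0_norm// mulr_ge0// ltW.
Qed.

(** The crude bound n + 1 <= 2^n absorbs the factor produced by differentiation, at the price of
    doubling [A]. *)
Lemma pseries_diffs_bounded {R : realType} (c : nat -> R) (A : R) :
  geometrically_bounded c A -> geometrically_bounded (pseries_diffs c) (2 * A).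
Proof.
move=> [A0 [B hB]]; split; first by rewrite mulr_gt0.
have B0 : 0 <= B by have := hB 0%N; rewrite expr0 mulr1; apply: le_trans.
exists (B * A) => n; rewrite /pseries_diffs normrM normr_nat exprMn.
apply: (@le_trans _ _ (2 ^+ n * (B * A ^+ n.+1))); last first.
  by rewrite le_eqVlt; apply/orP; left; apply/eqP; rewrite exprS; ring.
apply: ler_pM => //.
by rewrite -natrX ler_nat ltn_expl.
Qed.

(** [pseries_snd_diffs] asks for convergence of the series and of its first two formal derivatives
    at a point [K] beyond [z]; two doublings of [A] give the factor 4. *)
Lemma pseries_is_derive {R : realType} (c : nat -> R) (A z : R) :
  geometrically_bounded c A -> `|z| * (4 * A) < 1 ->
  is_derive z (1 : R) (fun z => limn (pseries c z)) (limn (pseries (pseries_diffs c) z)).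
Proof.
move=> cA zA; have A0 := cA.1.
pose K := (`|z| + (4 * A)^-1) / 2.
have zA' : `|z| < (4 * A)^-1 by rewrite -[ltRHS]mul1r ltr_pdivlMr// mulr_gt0.
have zK : `|z| < K by rewrite /K; lra.
have K0 : 0 <= K by apply: le_trans (ltW zK).
have K1 : `|K| * (4 * A) < 1.
  rewrite ger0_norm// -ltr_pdivlMr ?mulr_gt0// mul1r /K; lra.
have K2 A' : 0 < A' -> A' <= 4 * A -> `|K| * A' < 1.
  by move=> ? ?; apply: le_lt_trans K1; rewrite ler_wpM2l.
have c1 := pseries_diffs_bounded cA.
have c2 := pseries_diffs_bounded c1.
apply: (@pseries_snd_diffs _ c K).
- by apply: (pseries_bounded_cvg cA); apply: K2 => //; lra.
- by apply: (pseries_bounded_cvg c1); apply: K2 => //; lra.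
- by apply: (pseries_bounded_cvg c2); apply: K2 => //; lra.
- by rewrite (ger0_norm K0).
Qed.

(** Convergence at distance r / 2 from [t0], inside the given disc, already bounds the coefficients
    geometrically with rate 2 / r. *)
Lemma real_analytic_expansion {R : realType} (f : R -> R) (t0 : R) :
  real_analytic f -> exists (c : nat -> R) (A : R),
    geometrically_bounded c A /\
    forall t, `|t - t0| * (4 * A) < 1 -> f t = limn (pseries c (t - t0)).
Proof.
move=> /(_ t0)[c [r [r0 hc]]].
have K0 : 0 < r / 2 by rewrite divr_gt0.
have cA : geometrically_bounded c (r / 2)^-1.
  apply: pseries_cvg_bounded => //.
  have := hc (t0 + r / 2); rewrite [_ - t0]addrAC subrr add0r gtr0_norm//.
  by move=> /(_ _)/cvgP; apply; lra.
exists c, (r / 2)^-1; split=> // t tA; apply/esym/cvg_lim => //; apply: hc.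
move: tA; rewrite mulrA -ltr_pdivlMr ?invr_gt0// invrK mul1r.
have := normr_ge0 (t - t0); lra.
Qed.

Lemma nbhs_lt_mul {R : realType} (t0 t C : R) :
  0 < C -> `|t - t0| * C < 1 -> \forall s \near t, `|s - t0| * C < 1.
Proof.
move=> C0 tC; have := tC; rewrite -ltr_pdivlMr// mul1r => tC'.
near=> s; rewrite -ltr_pdivlMr// mul1r.
have -> : s - t0 = (t - t0) - (t - s) by ring.
apply: le_lt_trans (ler_normB _ _) _.
rewrite -ltrBrDl; near: s.
by apply: cvgr_dist_lt; rewrite ?subr_gt0.
Unshelve. all: by end_near. Qed.

Lemma real_analytic_local_derive {R : realType} (f : R -> R) (c : nat -> R) (A t0 t : R) :
  geometrically_bounded c A ->
  (forall t, `|t - t0| * (4 * A) < 1 -> f t = limn (pseries c (t - t0))) ->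
  `|t - t0| * (4 * A) < 1 ->
  is_derive t (1 : R) f (limn (pseries (pseries_diffs c) (t - t0))).
Proof.
move=> cA hf tA.
have A4 : 0 < 4 * A by rewrite mulr_gt0 ?cA.1.
have h1 := pseries_is_derive cA tA.
have h2 : is_derive t (1 : R) (fun s => limn (pseries c (s - t0)))
    (limn (pseries (pseries_diffs c) (t - t0))).
  have := @is_derive1_comp R (fun z => limn (pseries c z)) (fun s => s - t0) t
    (limn (pseries (pseries_diffs c) (t - t0))) 1 h1 _.
  rewrite mulr1; apply.
  by apply: is_derive_eq; rewrite subr0.
apply: near_eq_is_derive h2.
by near=> s; rewrite hf//; near: s; exact: nbhs_lt_mul.
Unshelve. all: by end_near. Qed.

Lemma real_analytic_derivable {R : realType} (f : R -> R) :
  real_analytic f -> forall t, derivable f t 1.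
Proof.
move=> fa t; have [c [A [cA hf]]] := real_analytic_expansion t fa.
have h : `|t - t| * (4 * A) < 1 by rewrite subrr normr0 mul0r.
by have [] := real_analytic_local_derive cA hf h.
Qed.

Lemma real_analytic_derive1 {R : realType} (f : R -> R) :
  real_analytic f -> real_analytic (derive1 f).
Proof.
move=> fa t0; have [c [A [cA hf]]] := real_analytic_expansion t0 fa.
have A4 : 0 < 4 * A by rewrite mulr_gt0 ?cA.1.
exists (pseries_diffs c), (4 * A)^-1; split=> [|t]; first by rewrite invr_gt0.
rewrite -[X in _ < X -> _]mul1r ltr_pdivlMr// => tA.
have h := real_analytic_local_derive cA hf tA.
rewrite derive1E derive_val.
apply: (pseries_bounded_cvg (pseries_diffs_bounded cA)).
apply: le_lt_trans tA; rewrite ler_wpM2l//; have := cA.1; lra.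
Qed.

Lemma real_analytic_lincomb {R : realType} (f g : R -> R) (x y : R) :
  real_analytic f -> real_analytic g ->
  real_analytic (fun t => x * f t + y * g t).
Proof.
move=> fa ga t0; have [c [r [r0 hc]]] := fa t0; have [d [q [q0 hd]]] := ga t0.
exists (fun n => x * c n + y * d n), (Num.min r q); split; first by rewrite lt_min r0.
move=> t; rewrite lt_min => /andP[tr tq].
have -> : pseries (fun n => x * c n + y * d n) (t - t0) =
  (fun n => x * pseries c (t - t0) n + y * pseries d (t - t0) n).
  apply/funext => n; rewrite /pseries /series /= !mulr_sumr -big_split /=.
  by apply: eq_bigr => i _; ring.
by apply: cvgD; apply: cvgM; [exact: cvg_cst|exact: hc|exact: cvg_cst|exact: hd].
Qed.

Lemma real_analytic_shift {R : realType} (f : R -> R) (u : R) :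
  real_analytic f -> real_analytic (fun t => f (u + t)).
Proof.
move=> fa t0; have [c [r [r0 hc]]] := fa (u + t0).
exists c, r; split=> // t; have -> : t - t0 = (u + t) - (u + t0) by ring.
exact: hc.
Qed.

Lemma real_analytic_flip {R : realType} (f : R -> R) :
  real_analytic f -> real_analytic (fun t => f (- t)).
Proof.
move=> fa t0; have [c [r [r0 hc]]] := fa (- t0).
exists (fun n => (-1) ^+ n * c n), r; split=> // t tr.
have -> : pseries (fun n => (-1) ^+ n * c n) (t - t0) = pseries c (- t - - t0).
  apply/funext => n; rewrite /pseries /series /=; apply: eq_bigr => i _.
  by rewrite (_ : - t - - t0 = -1 * (t - t0)) ?exprMn; ring.
by apply: hc; rewrite -opprD normrN.
Qed.

Lemma pseries_shift {R : realType} (c : nat -> R) (m : nat) (h : R) :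
  (forall n, (n < m)%N -> c n = 0) -> cvgn (pseries (fun n => c (m + n)%N) h) ->
  limn (pseries c h) = h ^+ m * limn (pseries (fun n => c (m + n)%N) h).
Proof.
move=> c0 hcv; apply/cvg_lim => //; rewrite -(cvg_shiftn m).
have -> : (fun n => pseries c h (n + m)%N) =
   (fun n => h ^+ m * pseries (fun n => c (m + n)%N) h n).
  apply/funext => n; rewrite /pseries /series /= (@big_cat_nat _ _ _ m)//= ?leq_addl//.
  rewrite big_nat big1 ?add0r; last by move=> i /andP[_ im]; rewrite c0 ?mul0r.
  rewrite -[X in index_iota X _]add0n big_addn addnK mulr_sumr; apply: eq_bigr => i _.
  by rewrite addnC exprD; ring.
by apply: cvgM => //; exact: cvg_cst.
Qed.

(* To leading order [f (t0 + h)] is [c_m h^m], unless [f] vanishes near [t0]. *)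
Lemma analytic_sign_right {R : realType} (f : R -> R) (t0 : R) :
  real_analytic f -> exists2 d : R, 0 < d &
  [\/ forall h, 0 < h < d -> 0 < f (t0 + h),
      forall h, 0 < h < d -> f (t0 + h) < 0 |
      forall h, `|h| < d -> f (t0 + h) = 0].
Proof.
move=> fa; have [c [A [cA hf]]] := real_analytic_expansion t0 fa.
have A4 : 0 < 4 * A by rewrite mulr_gt0 ?cA.1.
have hfh h : `|h| < (4 * A)^-1 -> f (t0 + h) = limn (pseries c h).
  rewrite -[X in _ < X -> _]mul1r ltr_pdivlMr// => hA.
  by rewrite hf [_ + h - t0]addrAC subrr add0r.
have [[n0 cn0]|c0] := pselect (exists n, c n != 0); last first.
  exists (4 * A)^-1; first by rewrite invr_gt0.
  constructor 3 => h /hfh ->; apply/cvg_lim => //.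
  have -> : pseries c h = cst 0; last exact: cvg_cst.
  apply/funext => n; rewrite /pseries /series /= big1// => i _.
  have /eqP -> : c i == 0 by apply: contra_notT c0 => ci; exists i.
  by rewrite mul0r.
have ex : exists n, c n != 0 by exists n0.
pose m := ex_minn ex.
have [cm cmin] : c m != 0 /\ forall n, (n < m)%N -> c n = 0.
  rewrite /m; case: ex_minnP => k ck kmin; split=> // n nk.
  by apply/eqP; apply: contraTT nk => /kmin; rewrite -leqNgt.
(* These are the coefficients of the cofactor [u] in f (t0 + h) = h^m u(h). It is continuous at 0
   with value [c m], which is nonzero, so it keeps the sign of [c m] nearby. *)
pose e n := c (m + n)%N.
have eA : geometrically_bounded e A.
  have [A0 [B hB]] := cA; split=> //; exists (B * A ^+ m) => n.
  by rewrite -mulrA -exprD; exact: hB.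
pose u h := limn (pseries e h).
have u0 : u 0 = c m.
  apply/cvg_lim => //; rewrite -cvg_shiftS.
  have -> : (fun n => pseries e 0 n.+1) = cst (c m); last exact: cvg_cst.
  apply/funext => n; rewrite /pseries /series /= big_nat_recl// expr0 mulr1.
  rewrite big1 ?addr0 ?/e ?addn0// => i _.
  by rewrite exprS mul0r mulr0.
have ucont : u h @[h --> 0] --> c m.
  rewrite -u0; apply: differentiable_continuous; apply/derivable1_diffP.
  have h0 : `|0 : R| * (4 * A) < 1 by rewrite normr0 mul0r.
  by have [] := pseries_is_derive eA h0.
have fu h : `|h| < (4 * A)^-1 -> f (t0 + h) = h ^+ m * u h.
  move=> hA; rewrite hfh// (pseries_shift cmin)//.
  apply: (pseries_bounded_cvg eA); apply: (@le_lt_trans _ _ (`|h| * (4 * A))).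
    by rewrite ler_wpM2l//; have := cA.1; lra.
  by rewrite -ltr_pdivlMr// mul1r.
have /cvgr_dist_lt/(_ `|c m|)[|d /= d0 hd] := ucont; first by rewrite normr_gt0.
exists (Num.min d (4 * A)^-1); first by rewrite lt_min invr_gt0 A4 d0.
have hsmall h : 0 < h < Num.min d (4 * A)^-1 ->
    [/\ 0 < h ^+ m, f (t0 + h) = h ^+ m * u h & `|c m - u h| < `|c m|].
  rewrite lt_min => /and3P[h0 hhd hA]; rewrite exprn_gt0// fu ?(gtr0_norm h0)//.
  by split=> //; apply: hd; rewrite /ball_ /= sub0r normrN (gtr0_norm h0).
have [cp|cn|/eqP] := ltgtP 0 (c m); last by rewrite eq_sym (negPf cm).
- constructor 1 => h /hsmall[hm -> ]; rewrite (gtr0_norm cp) ltr_norml => /andP[_ ?].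
  by rewrite mulr_gt0//; lra.
- constructor 2 => h /hsmall[hm -> ]; rewrite (ltr0_norm cn) ltr_norml => /andP[? _].
  by rewrite pmulr_rlt0//; lra.
Qed.

(** * Monotone quotients of analytic functions *)

Lemma derive_ge0_le {R : realType} (f df : R -> R) (a b : R) : a <= b ->
  (forall x, a <= x <= b -> is_derive x 1 f (df x)) ->
  (forall x, a < x < b -> 0 <= df x) -> f a <= f b.
Proof.
rewrite le_eqVlt => /predU1P[->//|ab] hd hp.
have [| |c + e] := @MVT _ f df a b ab.
- by move=> x; rewrite in_itv /= => /andP[? ?]; apply: hd; rewrite !ltW.
- apply: derivable_within_continuous => x; rewrite in_itv /= => /hd[].
  by move=> hx _.
- rewrite in_itv /= => cab.
  by rewrite -subr_ge0 e mulr_ge0 ?hp// subr_ge0 ltW.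
Qed.

Lemma derive_gt0_lt {R : realType} (f df : R -> R) (a b : R) : a < b ->
  (forall x, a <= x <= b -> is_derive x 1 f (df x)) ->
  (forall x, a < x < b -> 0 < df x) -> f a < f b.
Proof.
move=> ab hd hp; have [| |c + e] := @MVT _ f df a b ab.
- by move=> x; rewrite in_itv /= => /andP[? ?]; apply: hd; rewrite !ltW.
- apply: derivable_within_continuous => x; rewrite in_itv /= => /hd[].
  by move=> hx _.
- rewrite in_itv /= => cab.
  by rewrite -subr_gt0 e mulr_gt0 ?hp// subr_gt0.
Qed.

Lemma real_analytic_is_derive {R : realType} (f : R -> R) (x : R) :
  real_analytic f -> is_derive x 1 f (derive1 f x).
Proof. by move=> fa; rewrite derive1E; exact/derivableP/real_analytic_derivable. Qed.

Lemma real_analytic_continuous {R : realType} (f : R -> R) :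
  real_analytic f -> continuous f.
Proof.
move=> fa x; apply: differentiable_continuous; apply/derivable1_diffP.
exact: real_analytic_derivable.
Qed.

Lemma continuous_dist {R : realType} (f : R -> R) (t e : R) :
  {for t, continuous f} -> 0 < e ->
  exists2 d : R, 0 < d & forall h, `|h| < d -> `|f (t + h) - f t| < e.
Proof.
move=> /cvgr_dist_lt fa e0; have /nbhs_ballP[d /= d0 hd] := fa _ e0.
exists d => // h hh; rewrite distrC; apply: hd.
by rewrite /ball /= opprD addrA subrr add0r normrN.
Qed.

(** The derivative of W / G has numerator W' G - W G'. Once W <= 2 h W' is known, the second term is
    O(h) W' and is dominated by the first, because G is bounded below near 0. *)
Lemma ratio_nondecreasing {R : realType} (W G : R -> R) (d : R) :
  real_analytic W -> real_analytic G -> 0 < G 0 -> W 0 = 0 -> 0 < d ->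
  (forall h, 0 < h < d -> 0 < derive1 W h) ->
  exists2 r : R, 0 < r & forall x y, 0 <= x -> x <= y -> y <= r ->
    [/\ 0 < G x, 0 < G y & W x / G x <= W y / G y].
Proof.
move=> aW aG G0 W0 d0 W'0.
have aW' := real_analytic_derive1 aW; have aG' := real_analytic_derive1 aG.
have dW x := real_analytic_is_derive x aW; have dG x := real_analytic_is_derive x aG.
have dW' x := real_analytic_is_derive x aW'.
(* [W <= 2 h W'] to the right of 0: [W'] either increases, or it is
   comparable to [W' 0 > 0]. *)
have [e e0 We] : exists2 e : R, 0 < e & forall h, 0 < h < e ->
    0 < derive1 W h /\ W h <= 2 * h * derive1 W h.
  have [e1 e10 sg] := analytic_sign_right 0 (real_analytic_derive1 aW').
  pose nonneg := forall h, 0 < h < e1 -> 0 <= derive1 (derive1 W) h.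
  pose nonpos := forall h, 0 < h < e1 -> derive1 (derive1 W) h <= 0.
  have {sg}[sg|sg] : nonneg \/ nonpos.
    case: sg => sg; [left|right|left] => h hh; have /andP[h0 he] := hh.
    - by have := sg h hh; rewrite add0r => /ltW.
    - by have := sg h hh; rewrite add0r => /ltW.
    - by have := sg h; rewrite add0r gtr0_norm// => ->.
  - exists (Num.min d e1); first by rewrite lt_min d0.
    move=> h; rewrite lt_min => /and3P[h0 hd he].
    have Wh : 0 < derive1 W h by apply: W'0; rewrite h0.
    split=> //; apply: (@le_trans _ _ (h * derive1 W h)); last first.
      by have := mulr_gt0 h0 Wh; lra.
    have := @derive_ge0_le _ (fun x => x * derive1 W h - W x)
      (fun x => derive1 W h - derive1 W x) 0 h (ltW h0).
    rewrite mul0r W0 subrr subr_ge0; apply.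
      move=> x _; apply: is_derive_eq.
      by rewrite /GRing.scale /=; ring.
    move=> x /andP[x0 xh]; rewrite subr_ge0.
    apply: (@derive_ge0_le _ (derive1 W) (derive1 (derive1 W))) => //; first exact: ltW.
    by move=> y /andP[xy yh]; apply: sg; rewrite (lt_trans x0 xy) (lt_trans yh he).
  - have W'anti x y : 0 <= x -> x <= y -> y < e1 -> derive1 W y <= derive1 W x.
      move=> x0 xy ye; rewrite -lerN2.
      apply: (@derive_ge0_le _ (fun x => - derive1 W x) (fun x => - derive1 (derive1 W) x)) => //.
      move=> z /andP[xz zy]; rewrite oppr_ge0; apply: sg.
      by rewrite (le_lt_trans x0 xz) (lt_trans zy ye).
    (* [W'] is nonincreasing in this case, so its value at 0 is at least a positive value taken to
       the right. *)
    have W'00 : 0 < derive1 W 0.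
      pose h := Num.min d e1 / 2.
      have m0 : 0 < Num.min d e1 by rewrite lt_min d0.
      have h0 : 0 < h by rewrite divr_gt0.
      have : h < Num.min d e1 by rewrite /h; lra.
      rewrite lt_min => /andP[hd he].
      by apply: lt_le_trans (W'anti 0 h (lexx _) (ltW h0) he); apply: W'0; rewrite h0.
    have [e2 e20 he2] := continuous_dist (@real_analytic_continuous _ _ aW' 0) (divr_gt0 W'00 (ltr0Sn _ 1)).
    exists (Num.min (Num.min d e1) e2); first by rewrite !lt_min d0 e10.
    move=> h; rewrite !lt_min => /andP[h0 /andP[/andP[hd he] hhe2]].
    split; first by apply: W'0; rewrite h0.
    have := he2 h; rewrite gtr0_norm// add0r => /(_ hhe2); rewrite ltr_norml => /andP[hl _].
    apply: (@le_trans _ _ (h * derive1 W 0)); last first.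
      have -> : 2 * h * derive1 W h = h * (2 * derive1 W h) by ring. 
      by rewrite ler_wpM2l ?ltW//; lra.
    have := @derive_ge0_le _ (fun x => x * derive1 W 0 - W x)
      (fun x => derive1 W 0 - derive1 W x) 0 h (ltW h0).
    rewrite mul0r W0 subrr subr_ge0; apply.
      move=> x _; apply: is_derive_eq.
      by rewrite /GRing.scale /=; ring.
    move=> x /andP[x0 xh]; rewrite subr_ge0; apply: W'anti => //; first exact: ltW.
    exact: lt_trans he.
have [e2 e20 hG] := continuous_dist (@real_analytic_continuous _ _ aG 0) (divr_gt0 G0 (ltr0Sn _ 1)).
have [e3 e30 hG'] := continuous_dist (@real_analytic_continuous _ _ aG' 0) ltr01.
pose B := `|derive1 G 0| + 1.
have B0 : 0 < B by rewrite ltr_wpDl.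
(* For z < e4 one has 2 z B < G 0 / 2 < G z, hence W z G' z <= 2 z B W' z <= W' z G z. *)
pose e4 := G 0 / (4 * B).
have e40 : 0 < e4 by rewrite divr_gt0// mulr_gt0.
pose r := Num.min (Num.min e e2) (Num.min e3 e4) / 2.
have m0 : 0 < Num.min (Num.min e e2) (Num.min e3 e4) by rewrite !lt_min e0 e20 e30.
have : r < Num.min (Num.min e e2) (Num.min e3 e4) by rewrite /r; lra.
have r0 : 0 < r by rewrite divr_gt0.
rewrite !lt_min => /andP[/andP[re re2] /andP[re3 re4]].
have Gpos x : 0 <= x <= r -> G 0 / 2 < G x.
  move=> /andP[x0 xr]; have := hG x; rewrite ger0_norm// add0r => /(_ (le_lt_trans xr re2)).
  by rewrite ltr_norml => /andP[? _]; lra.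
exists r => // x y x0 xy yr.
have Gx : 0 < G x by apply: lt_trans (divr_gt0 G0 (ltr0Sn _ 1)) (Gpos _ _); rewrite x0 (le_trans xy).
have Gy : 0 < G y by apply: lt_trans (divr_gt0 G0 (ltr0Sn _ 1)) (Gpos _ _); rewrite yr (le_trans x0).
split=> //.
apply: (@derive_ge0_le _ (fun x => W x / G x)
  (fun x => (derive1 W x * G x - W x * derive1 G x) / G x ^+ 2)) => //.
  move=> z /andP[xz zy].
  have Gz : G z != 0.
    apply: lt0r_neq0; apply: lt_trans (divr_gt0 G0 (ltr0Sn _ 1)) (Gpos _ _).
    by rewrite (le_trans x0 xz) (le_trans zy yr).
  have dV := is_deriveV Gz (dG z).
  apply: (is_derive_eq (is_deriveM (dW z) dV)).
  rewrite /= -![_ *: _]/(_ * _); field.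
  exact: Gz.
move=> z /andP[xz zy]; rewrite divr_ge0 ?sqr_ge0// subr_ge0.
have z0 : 0 < z by exact: le_lt_trans xz.
have zr : z < r by exact: lt_le_trans yr.
have [W'z Wz] : 0 < derive1 W z /\ W z <= 2 * z * derive1 W z.
  by apply: We; rewrite z0 (lt_trans zr).
have Gz : G 0 / 2 < G z by apply: Gpos; rewrite !ltW.
have G'z : `|derive1 G z| <= B.
  have := hG' z; rewrite gtr0_norm// add0r => /(_ (lt_trans zr re3)) h.
  rewrite -[derive1 G z](subrK (derive1 G 0)) (le_trans (ler_normD _ _))// addrC /B.
  by rewrite lerD2l ltW.
have Wz0 : 0 <= W z.
  rewrite -W0; apply: (@derive_ge0_le _ W (derive1 W)) => //; first exact: ltW.
  move=> u /andP[u0 uz]; have [] // := We u; last by move/ltW.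
  by rewrite u0 (lt_trans uz)// (lt_trans zr).
apply: (@le_trans _ _ (W z * B)).
  by rewrite ler_wpM2l// (le_trans (ler_norm _)).
apply: (@le_trans _ _ (2 * z * derive1 W z * B)); first by rewrite ler_wpM2r// ltW.
rewrite mulrAC [_ * derive1 W z]mulrC ler_wpM2l// ?ltW//.
have : z * (4 * B) < G 0 by rewrite -ltr_pdivlMr ?mulr_gt0//; exact: lt_trans re4.
lra.
Qed.

(** Subtracting the value q at 0 gives F / G - q = (F - q G) / G, whose numerator is analytic and
    vanishes at 0. The sign of its derivative to the right of 0 decides the direction of
    monotonicity. *)
Lemma analytic_ratio_monotone {R : realType} (F G : R -> R) :
  real_analytic F -> real_analytic G -> 0 < G 0 ->
  exists2 r : R, 0 < r &
    (forall x y, 0 <= x -> x <= y -> y <= r -> F x / G x <= F y / G y) \/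
    (forall x y, 0 <= x -> x <= y -> y <= r -> F y / G y <= F x / G x).
Proof.
move=> aF aG G0; pose q := F 0 / G 0.
pose W s t := s * F t + - (s * q) * G t.
have aW s : real_analytic (W s) by apply: real_analytic_lincomb.
have W0 s : W s 0 = 0 by rewrite /W /q; field; rewrite gt_eqF.
have Wr s x : 0 < G x -> W s x / G x = s * (F x / G x) - s * q.
  by move=> Gx; rewrite /W; field; rewrite gt_eqF.
have dW s x : derive1 (W s) x = s * derive1 F x - s * q * derive1 G x.
  rewrite derive1E; apply: derive_val.
  have ? := real_analytic_is_derive x aF; have ? := real_analytic_is_derive x aG.
  by apply: is_derive_eq; rewrite /GRing.scale /=; ring.
have [d d0 []] := analytic_sign_right 0 (real_analytic_derive1 (aW 1)).
- move=> hd; have [r r0 hr] := ratio_nondecreasing (aW 1) aG G0 (W0 1) d0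
    (fun h hh => ltac:(have := hd h hh; rewrite add0r; exact: id)).
  exists r => //; left=> x y x0 xy yr; have [Gx Gy] := hr x y x0 xy yr.
  by rewrite !Wr// !mul1r lerD2r.
- move=> hd.
  have hd' h : 0 < h < d -> 0 < derive1 (W (-1)) h.
    by move=> hh; have := hd h hh; rewrite add0r !dW; lra.
  have [r r0 hr] := ratio_nondecreasing (aW (-1)) aG G0 (W0 (-1)) d0 hd'.
  exists r => //; right=> x y x0 xy yr; have [Gx Gy] := hr x y x0 xy yr.
  by rewrite !Wr//; lra.
(* The derivative of F - q G vanishes near 0, so F / G is the constant [q] there and either
   alternative would do. *)
- move=> hd.
  have [e e0 he] := continuous_dist (real_analytic_continuous aG (x := 0)) G0.
  pose r := Num.min d e / 2.
  have m0 : 0 < Num.min d e by rewrite lt_min d0.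
  have r0 : 0 < r by rewrite divr_gt0.
  have : r < Num.min d e by rewrite /r; lra.
  rewrite lt_min => /andP[rd re].
  have FG x : 0 <= x <= r -> F x / G x = q.
    move=> /andP[x0 xr].
    have Gx : 0 < G x.
      have := he x; rewrite ger0_norm// add0r => /(_ (le_lt_trans xr re)).
      by rewrite ltr_norml => /andP[? _]; lra.
    suff : W 1 x = 0 by move=> Wx; have := Wr 1 x Gx; rewrite Wx mul0r !mul1r; lra.
    have dz z : 0 < z < x -> derive1 (W 1) z = 0.
      move=> /andP[z0 zx]; have := hd z; rewrite add0r gtr0_norm// => -> //.
      by apply: lt_trans zx _; exact: le_lt_trans rd.
    have : W 1 0 <= W 1 x.
      apply: (@derive_ge0_le _ (W 1) (derive1 (W 1))) => //.
        by move=> z _; exact: real_analytic_is_derive.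
      by move=> z /dz ->.
    have : - W 1 0 <= - W 1 x.
      apply: (@derive_ge0_le _ (fun t => - W 1 t) (fun t => - derive1 (W 1) t)) => //.
        by move=> z _; have ? := real_analytic_is_derive z (aW 1); exact: is_derive_eq.
      by move=> z /dz ->; rewrite oppr0.
    by rewrite W0; lra.
  exists r => //; left=> x y x0 xy yr.
  by rewrite !FG// ?x0 ?yr ?(le_trans xy)// (le_trans x0).
Qed.

Lemma analytic_ratio_monotone_left {R : realType} (F G : R -> R) :
  real_analytic F -> real_analytic G -> 0 < G 0 ->
  exists2 r : R, 0 < r &
    (forall x y, - r <= x -> x <= y -> y <= 0 -> F x / G x <= F y / G y) \/
    (forall x y, - r <= x -> x <= y -> y <= 0 -> F y / G y <= F x / G x).
Proof.
move=> aF aG G0; have G0' : 0 < G (- 0) by rewrite oppr0.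
have [r r0 h] := analytic_ratio_monotone (real_analytic_flip aF) (real_analytic_flip aG) G0'.
exists r => //; case: h => h; [right|left] => x y x0 xy yr;
  by have := h (- y) (- x); rewrite !opprK; apply; rewrite ?oppr_ge0 ?lerN2// lerNl.
Qed.

(** * Chords of an arc with monotone curvature *)

Lemma sin_lt {R : realType} (x y : R) : -1 <= x -> x < y -> y <= 1 -> sin x < sin y.
Proof.
move=> x1 xy y1; have := pi_ge2 R => pi2.
by rewrite ltr_sin// in_itv /=; apply/andP; split; lra.
Qed.

Lemma sin_le {R : realType} (x y : R) : -1 <= x -> x <= y -> y <= 1 -> sin x <= sin y.
Proof.
by rewrite [x <= y]le_eqVlt => x1 /predU1P[->//|xy y1]; apply/ltW/sin_lt.
Qed.

Lemma is_derive_shiftl {R : realType} (f : R -> R) (a u d : R) :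
  is_derive (a + u) 1 f d -> is_derive u 1 (fun u => f (a + u)) d.
Proof.
move=> h; have h' : is_derive u 1 (fun u => a + u) (1 : R).
  by apply: is_derive_eq; ring.
by have := @is_derive1_comp R f (fun u => a + u) u d 1 h h'; rewrite mulr1.
Qed.

Lemma is_derive_reflect {R : realType} (f : R -> R) (a u d : R) :
  is_derive (a - u) 1 f d -> is_derive u 1 (fun u => f (a - u)) (- d).
Proof.
move=> h; have h' : is_derive u 1 (fun u => a - u) (-1 : R).
  by apply: is_derive_eq; ring.
by have := @is_derive1_comp R f (fun u => a - u) u d (-1) h h'; rewrite mulrN1.
Qed.

Lemma additive_growth_unbounded {R : realType} (u : nat -> R) (e C : R) : 0 < e ->
  (forall i, u i + e <= u i.+1) -> ~ (forall i, u i <= C).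
Proof.
move=> e0 hu hC.
have un n : u 0%N + n%:R * e <= u n.
  elim: n => [|n IH]; first by rewrite mul0r addr0.
  by apply: le_trans (hu n); rewrite -natr1 mulrDl mul1r addrA lerD2r.
pose n := (Num.truncn ((C - u 0%N) / e)).+1.
have : (C - u 0%N) / e < n%:R by exact: truncnS_gt.
rewrite ltr_pdivrMr// => h.
by have := un n; have := hC n; lra.
Qed.

Section Chords.
Context {R : realType}.
(** A unit-speed arc with tangent angle [psi] and curvature [k], positive where the domain, which
    lies above the arc, is convex. The i-th chord joins the bounces [s i] and [s i.+1] at angle
    [chi i]; at a bounce the tangent bisects the two chord directions. Parameters are nonpositive
    because the bounces move right towards the limit point 0. *)
Variables (X Y psi k : R -> R) (r : R) (s chi : nat -> R).
Hypothesis dX : forall x, - r <= x <= 0 -> is_derive x 1 X (cos (psi x)).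
Hypothesis dY : forall x, - r <= x <= 0 -> is_derive x 1 Y (sin (psi x)).
Hypothesis dpsi : forall x, - r <= x <= 0 -> is_derive x 1 psi (k x).
Hypothesis psi_small : forall x, - r <= x <= 0 -> `|psi x| <= 1 / 4.
Hypothesis chi_small : forall i, `|chi i| <= 1 / 4.
Hypothesis s_range : forall i, - r <= s i <= 0.
Hypothesis s_lt : forall i, s i < s i.+1.
Hypothesis reflection : forall i, chi i + chi i.+1 = 2 * psi (s i.+1).

(* Up to a constant, the height of the curve over the line of the i-th chord. *)
Let H i x := Y x * cos (chi i) - X x * sin (chi i).
Hypothesis H_chord : forall i, H i (s i) = H i (s i.+1).
Hypothesis H_below : forall i x, s i < x < s i.+1 -> H i x < H i (s i).

Let dH i x : - r <= x <= 0 -> is_derive x 1 (H i) (sin (psi x - chi i)).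
Proof.
move=> xr; have ? := dX xr; have ? := dY xr.
by apply: is_derive_eq; rewrite sinB /GRing.scale /=; ring.
Qed.

Let phi_small i x : - r <= x <= 0 -> `|psi x - chi i| <= 1.
Proof.
move=> xr; apply: le_trans (ler_normB _ _) _.
by have := psi_small xr; have := chi_small i; lra.
Qed.

(* Seen from the bounce [s i.+1], both chords start at the same angle to the
   curve; the curve bends up less after the bounce than before it, so the next
   chord cannot be the shorter one. *)
Lemma chords_gap_nondecreasing i :
  (forall x y, - r <= x -> x <= y -> y <= 0 -> k y <= k x) ->
  s i.+1 - s i <= s i.+2 - s i.+1.
Proof.
move=> km; rewrite leNgt; apply/negP => lt_gap.
pose L := s i.+2 - s i.+1; have L0 : 0 < L by rewrite subr_gt0.
set a := s i.+1 in lt_gap L L0.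
have [a1 a2] := andP (s_range i.+1); have [b1 b2] := andP (s_range i).
have [c1 c2] := andP (s_range i.+2).
have rgl u : 0 <= u <= L -> - r <= a + u <= 0.
  by rewrite /L -/a; rewrite -/a in a1; lra.
have rgr u : 0 <= u <= L -> - r <= a - u <= 0.
  by rewrite /L -/a; rewrite -/a in a1 a2; lra.
(* Equality holds at u = 0 by reflection, and the difference of the two sides has derivative k (a -
   u) - k (a + u) >= 0. *)
have phile u : 0 <= u <= L ->
    psi (a + u) - chi i.+1 <= chi i - psi (a - u).
  move=> /andP[u0 uL].
  have := @derive_ge0_le _ (fun u => - psi (a + u) - psi (a - u))
    (fun u => - k (a + u) + k (a - u)) 0 u u0.
  rewrite addr0 subr0 => hh.
  suff : - psi a - psi a <= - psi (a + u) - psi (a - u).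
    by have := reflection i; rewrite -/a; lra.
  apply: hh.
    move=> x /andP[x0 xu]; have xL : 0 <= x <= L by rewrite x0 (le_trans xu).
    have ? := is_derive_shiftl (dpsi (rgl x xL)).
    have ? := is_derive_reflect (dpsi (rgr x xL)).
    by apply: is_derive_eq; rewrite opprK.
  move=> x /andP[x0 xu]; have xL : 0 <= x <= L by rewrite ltW//= ltW// (lt_le_trans xu).
  have := km (a - x) (a + x); have := rgl x xL; have := rgr x xL.
  move=> /andP[? ?] /andP[? ?] /(_ _ _ _) hk; rewrite addrC subr_ge0; apply: hk => //; lra.
have := @derive_ge0_le _ (fun u => H i (a - u) - H i.+1 (a + u))
  (fun u => - sin (psi (a - u) - chi i) - sin (psi (a + u) - chi i.+1)) 0 L (ltW L0).
rewrite addr0 subr0 => hh.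
(* At u = L the arc is back on the line of the next chord, so the inequality leaves H i a <= H i (a
   - L). But a - L lies strictly inside the previous, longer gap, where the arc is below its
   chord. *)
suff main : H i a - H i.+1 a <= H i (a - L) - H i.+1 (a + L).
  have aL : a + L = s i.+2 by rewrite /L; ring.
  have : H i (a - L) < H i (s i) by apply: H_below; rewrite -/a; move: lt_gap L0; rewrite -/L; lra.
  by move: main; rewrite aL (H_chord i) -(H_chord i.+1) -/a; lra.
apply: hh => x.
  move=> xL; have ? := is_derive_reflect (dH i (rgr x xL)).
  have ? := is_derive_shiftl (dH i.+1 (rgl x xL)).
  exact: is_derive_eq.
move=> /andP[x0 xL]; have xL' : 0 <= x <= L by rewrite !ltW.
rewrite -sinN subr_ge0; apply: sin_le.
- by have := phi_small i.+1 (rgl x xL'); rewrite ler_norml => /andP[].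
- by have := phile x xL'; lra.
- by rewrite opprB; have := phi_small i (rgr x xL'); rewrite ler_norml => /andP[? _]; lra.
Qed.

(* On a chord [psi - chi] is convex in the parameter and its sine has mean 0, so
   its value at the right end is at least the opposite of that at the left end,
   which by reflection is the previous bounce angle. *)
Lemma chords_angle_nondecreasing i :
  (forall x y, - r <= x -> x <= y -> y <= 0 -> k x <= k y) ->
  psi (s i.+1) - chi i <= psi (s i.+2) - chi i.+1.
Proof.
move=> km; rewrite leNgt; apply/negP => lt_angle.
have [a1 a2] := andP (s_range i.+1); have [b1 b2] := andP (s_range i.+2).
set a := s i.+1 in lt_angle a1 a2 *; set b := s i.+2 in lt_angle b1 b2 *.
have ab : a < b by exact: s_lt.
(* The chord is folded at its middle: a + u is paired with b - u. *)
pose L := (b - a) / 2; have L0 : 0 < L by rewrite /L; lra.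
have rga u : 0 <= u <= L -> - r <= a + u <= 0 by rewrite /L; lra.
have rgb u : 0 <= u <= L -> - r <= b - u <= 0 by rewrite /L; lra.
have phil u : 0 <= u <= L -> psi (a + u) + psi (b - u) <= psi a + psi b.
  move=> /andP[u0 uL].
  have := @derive_ge0_le _ (fun u => - psi (a + u) - psi (b - u))
    (fun u => - k (a + u) + k (b - u)) 0 u u0.
  rewrite addr0 subr0 => hh.
  suff : - psi a - psi b <= - psi (a + u) - psi (b - u) by lra.
  apply: hh.
    move=> x /andP[x0 xu]; have xL : 0 <= x <= L by rewrite x0 (le_trans xu).
    have ? := is_derive_shiftl (dpsi (rga x xL)).
    have ? := is_derive_reflect (dpsi (rgb x xL)).
    by apply: is_derive_eq; rewrite opprK.
  move=> x /andP[x0 xu]; have xL : 0 <= x <= L by rewrite ltW//= ltW// (lt_le_trans xu).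
  have := km (a + x) (b - x); have := rga x xL; have := rgb x xL.
  move=> /andP[? ?] /andP[? ?] /(_ _ _ _) hk; rewrite addrC subr_ge0; apply: hk => //.
  by move: xu uL; rewrite /L; lra.
have := @derive_gt0_lt _ (fun u => H i.+1 (b - u) - H i.+1 (a + u))
  (fun u => - sin (psi (b - u) - chi i.+1) - sin (psi (a + u) - chi i.+1)) 0 L L0.
rewrite addr0 subr0 => hh.
(* If the angle dropped, reflection would give psi a + psi b < 2 chi, and by [phil] the two sines at
   paired points would have negative sum. The folded height difference would then increase strictly
   on [0, L], although it is 0 at both ends. *)
suff : H i.+1 b - H i.+1 a < H i.+1 (b - L) - H i.+1 (a + L).
  have -> : b - L = a + L by rewrite /L; lra.
  by rewrite -(H_chord i.+1) -/a; lra.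
apply: hh => x.
  move=> xL; have ? := is_derive_reflect (dH i.+1 (rgb x xL)).
  have ? := is_derive_shiftl (dH i.+1 (rga x xL)).
  exact: is_derive_eq.
move=> /andP[x0 xL]; have xL' : 0 <= x <= L by rewrite !ltW.
rewrite -sinN subr_gt0; apply: sin_lt.
- by have := phi_small i.+1 (rga x xL'); rewrite ler_norml => /andP[].
- by have := phil x xL'; have := reflection i; rewrite -/a; lra.
- by rewrite opprB; have := phi_small i.+1 (rgb x xL'); rewrite ler_norml => /andP[? _]; lra.
Qed.

(** The arc lies under its chord and rejoins it at [s i.+1], so it cannot be descending relative to
    the chord there. *)
Lemma chords_angle_ge0 i : 0 <= psi (s i.+1) - chi i.
Proof.
rewrite leNgt; apply/negP => lt0.
have [a1 a2] := andP (s_range i.+1); have [b1 b2] := andP (s_range i).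
set a := s i.+1 in lt0 a1 a2 *.
have ba : s i < a by exact: s_lt.
have cpsi : {for a, continuous psi}.
  apply: differentiable_continuous; apply/derivable1_diffP.
  by have [] := @dpsi a; rewrite ?a1.
have [d d0 hd] : exists2 d : R, 0 < d & forall h, `|h| < d -> `|psi (a + h) - psi a| < chi i - psi a.
  by apply: continuous_dist => //; lra.
(* Close enough to [a] for [psi] to stay below [chi i] on [x, a], and still strictly inside the
   gap. *)
pose x := Num.max (a - d / 2) ((s i + a) / 2).
have xa : x < a by rewrite gt_max; apply/andP; split; lra.
have sx : s i < x by rewrite lt_max; apply/orP; right; lra.
have xd : a - d / 2 <= x by rewrite le_max lexx.
have := H_below (i := i) (x := x); rewrite sx xa H_chord -/a => /(_ isT); apply/negP; rewrite -leNgt.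
rewrite -lerN2; apply: (@derive_ge0_le _ (fun x => - H i x) (fun x => - sin (psi x - chi i))).
- exact: ltW.
- move=> z /andP[xz za]; have zr : - r <= z <= 0 by lra.
  by have ? := dH i zr; exact: is_derive_eq.
- move=> z /andP[xz za]; have zr : - r <= z <= 0 by lra.
  rewrite -sinN -(sin0 R); apply: sin_le; first by lra.
    have := hd (z - a); rewrite (_ : a + (z - a) = z); last by ring.
    have za' : `|z - a| < d by rewrite ltr_norml; apply/andP; split; lra.
    by move=> /(_ za'); rewrite ltr_norml => /andP[? ?]; lra.
  by have := phi_small i zr; rewrite ler_norml => /andP[? _]; lra.
Qed.

(** If this angle were 0, so would be the previous one, being nonnegative and no larger. By
    reflection psi - chi would vanish at both ends of the chord; being convex it would be
    nonpositive in between, and the arc could not climb back to its chord. *)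
Lemma chords_angle_gt0 i :
  (forall x y, - r <= x -> x <= y -> y <= 0 -> k x <= k y) ->
  0 < psi (s i.+2) - chi i.+1.
Proof.
move=> km; rewrite lt_neqAle chords_angle_ge0 andbT; apply/negP => /eqP e0.
have e1 : psi (s i.+1) - chi i.+1 = 0.
  have := chords_angle_ge0 i; have := chords_angle_nondecreasing i km.
  by have := reflection i; lra.
have [a1 a2] := andP (s_range i.+1); have [b1 b2] := andP (s_range i.+2).
set a := s i.+1 in e1 a1 a2 *; set b := s i.+2 in e0 b1 b2 *.
have ab : a < b by exact: s_lt.
have phile x : a < x < b -> psi x - chi i.+1 <= 0.
  move=> /andP[ax xb]; rewrite leNgt; apply/negP => p0.
  have dd z : - r <= z <= 0 -> derivable psi z 1 by case/dpsi.
  (* A positive value of psi - chi at an inner [x] would give a positive slope somewhere before [x]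
     and a negative one after it, against monotone [k]. *)
  have [| |c1] := @MVT _ psi k a x ax.
  - by move=> z; rewrite in_itv /= => /andP[? ?]; apply: dpsi; lra.
  - by apply: derivable_within_continuous => z; rewrite in_itv /= => ?; apply: dd; lra.
  rewrite in_itv /= => /andP[ac1 c1x] m1.
  have [| |c2] := @MVT _ psi k x b xb.
  - by move=> z; rewrite in_itv /= => /andP[? ?]; apply: dpsi; lra.
  - by apply: derivable_within_continuous => z; rewrite in_itv /= => ?; apply: dd; lra.
  rewrite in_itv /= => /andP[xc2 c2b] m2.
  have k1 : 0 < k c1.
    by have : 0 < k c1 * (x - a) by [lra]; rewrite pmulr_lgt0// subr_gt0.
  have k2 : k c2 < 0.
    by have : k c2 * (b - x) < 0 by [lra]; rewrite pmulr_llt0// subr_gt0.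
  by have := km c1 c2; lra.
have := H_below (i := i.+1) (x := (a + b) / 2).
have -> : s i.+1 < (a + b) / 2 < s i.+2 by rewrite -/a -/b; lra.
move=> /(_ isT); rewrite H_chord -/b; apply/negP; rewrite -leNgt -lerN2.
apply: (@derive_ge0_le _ (fun x => - H i.+1 x) (fun x => - sin (psi x - chi i.+1))).
- lra.
- move=> z /andP[xz za]; have zr : - r <= z <= 0 by lra.
  by have ? := dH i.+1 zr; exact: is_derive_eq.
- move=> z /andP[xz za]; have zr : - r <= z <= 0 by lra.
  rewrite -sinN -(sin0 R); apply: sin_le; first by lra.
    by rewrite oppr_ge0; apply: phile; lra.
  by have := phi_small i.+1 zr; rewrite ler_norml => /andP[? _]; lra.
Qed.

Lemma chords_contradiction :
  (forall x y, - r <= x -> x <= y -> y <= 0 -> k x <= k y) \/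
  (forall x y, - r <= x -> x <= y -> y <= 0 -> k y <= k x) -> False.
Proof.
case=> km.
(* Positivity is known from the second chord on, hence the lower bound [th 1]. Reflection gives psi
   (s i.+3) - psi (s i.+2) = th i.+1 + th i.+2, so [psi] gains at least [th 1] per bounce. *)
- pose th i := psi (s i.+1) - chi i.
  have th_ge i : th 1%N <= th i.+1.
    elim: i => // i IH; apply: le_trans IH _; exact: chords_angle_nondecreasing.
  have th0 : 0 < th 1%N by exact: chords_angle_gt0.
  apply: (@additive_growth_unbounded _ (fun i => psi (s i.+2)) (th 1%N) (1 / 4)) => // i.
    have := th_ge i; have := th_ge i.+1; have := reflection i.+1.
    by rewrite /th; rewrite /th in th0; lra.
  by have := psi_small (s_range i.+2); rewrite ler_norml => /andP[].
- have g_ge i : s 1%N - s 0%N <= s i.+1 - s i.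
    elim: i => // i IH; apply: le_trans IH _; exact: chords_gap_nondecreasing.
  apply: (@additive_growth_unbounded _ s (s 1%N - s 0%N) 0) => [|i|i].
  + by rewrite subr_gt0.
  + by have := g_ge i; lra.
  + by have /andP[] := s_range i.
Qed.

End Chords.

(** * From Cartesian coordinates to angles *)

Lemma small_angle {R : realType} (y : R) : `|y| <= sin (1 / 4) ->
  [/\ `|asin y| <= 1 / 4, sin (asin y) = y & cos (asin y) = Num.sqrt (1 - y ^+ 2)].
Proof.
move=> ys; have s1 := sin_le1 (1 / 4 : R); have p2 := pi_ge2 R.
have yr : -1 <= y <= 1 by move: ys; rewrite ler_norml; lra.
have e : sin (asin y) = y by apply: asinK; rewrite in_itv.
have sl := asin_lepi2 yr; have sg := asin_geNpi2 yr.
split=> //; last exact: cos_asin.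
move: ys; rewrite !ler_norml => /andP[y1 y2]; apply/andP; split; rewrite leNgt; apply/negP => h.
  have : sin (asin y) < sin (- (1 / 4)) by rewrite ltr_sin// in_itv /=; apply/andP; split; lra.
  by rewrite sinN e; lra.
have : sin (1 / 4) < sin (asin y) by rewrite ltr_sin// in_itv /=; apply/andP; split; lra.
by rewrite e; lra.
Qed.

(** The angles are [psi = asin Y'] and [chi i = asin (d i).2]. The radius [r] depends on the curve
    alone: it makes Y'' / X' monotone on [-r, 0] and the arc flat enough for both angles to be at
    most 1/4. *)
Lemma no_bounded_billiard {R : realType} (X Y : R -> R) :
  real_analytic X -> real_analytic Y ->
  (forall x, derive1 X x ^+ 2 + derive1 Y x ^+ 2 = 1) ->
  derive1 X 0 = 1 ->
  exists2 r : R, 0 < r & forall (s : nat -> R) (d : nat -> R * R),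
  (forall i, - r <= s i <= 0) -> (forall i, s i < s i.+1) ->
  (forall i, dot (d i) (d i) = 1 /\ 0 < (d i).1) ->
  (forall i, exists2 T : R, 0 < T &
     X (s i.+1) - X (s i) = T * (d i).1 /\ Y (s i.+1) - Y (s i) = T * (d i).2) ->
  (forall i, (d i.+1).2 = 2 * (derive1 X (s i.+1) * (d i).1 + derive1 Y (s i.+1) * (d i).2)
      * derive1 Y (s i.+1) - (d i).2) ->
  (forall i x, s i < x < s i.+1 ->
     Y x * (d i).1 - X x * (d i).2 < Y (s i) * (d i).1 - X (s i) * (d i).2) -> False.
Proof.
move=> aX aY unit X'0.
have aX' := real_analytic_derive1 aX; have aY' := real_analytic_derive1 aY.
have Y'0 : derive1 Y 0 = 0.
  by apply/eqP; rewrite -sqrf_eq0; have := unit 0; rewrite X'0; lra.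
have p2 := pi_ge2 R.
have sg0 : 0 < sin (1 / 4 : R) by apply: sin_gt0_pihalf; lra.
set sg := sin (1 / 4 : R) in sg0 *.
have [r1 r10 mono] := analytic_ratio_monotone_left (real_analytic_derive1 aY') aX'
  (eq_ind_r (fun z => 0 < z) ltr01 X'0).
have [r2 r20 hX] := continuous_dist (real_analytic_continuous aX' (x := 0)) (divr_gt0 ltr01 (ltr0Sn R 1)).
have [r3 r30 hY] := continuous_dist (real_analytic_continuous aY' (x := 0)) (divr_gt0 sg0 (ltr0Sn R 1)).
pose r := Num.min r1 (Num.min r2 r3) / 2.
have m0 : 0 < Num.min r1 (Num.min r2 r3) by rewrite !lt_min r10 r20.
have r0 : 0 < r by rewrite divr_gt0.
have : r < Num.min r1 (Num.min r2 r3) by rewrite /r; lra.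
rewrite !lt_min => /and3P[rr1 rr2 rr3].
have X'r x : - r <= x <= 0 -> 1 / 2 < derive1 X x.
  move=> xr; have xn : `|x| < r2 by rewrite ltr_norml; apply/andP; split; lra.
  by have := hX x xn; rewrite add0r X'0 ltr_norml => /andP[? _]; lra.
have Y'r x : - r <= x <= 0 -> `|derive1 Y x| < sg / 2.
  move=> xr; have xn : `|x| < r3 by rewrite ltr_norml; apply/andP; split; lra.
  by have := hY x xn; rewrite add0r Y'0 subr0.
exists r => // s d sr slt dunit chord refl below.
pose psi x := asin (derive1 Y x).
have psiP x : - r <= x <= 0 -> [/\ `|psi x| <= 1 / 4, sin (psi x) = derive1 Y x & cos (psi x) = derive1 X x].
  move=> xr; have [|h1 h2 h3] := @small_angle _ (derive1 Y x).
    by apply: le_trans (ltW (Y'r x xr)) _; rewrite -/sg; lra.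
  split=> //; rewrite /psi h3 -(unit x) addrK sqrtr_sqr ger0_norm//.
  by have := X'r x xr; lra.
have dsmall i : `|(d i).2| <= sg.
  have [T T0 [TX TY]] := chord i; have [d1 d10] := dunit i.
  (* [sg * X - e * Y] is nondecreasing since |Y'| < sg / 2 < sg X', so the slope of a chord is at
     most [sg], like that of the arc. *)
  have dle e : `|e| = 1 -> e * (d i).2 <= sg * (d i).1.
    move=> e1; rewrite -subr_ge0 -(pmulr_rge0 _ T0).
    have -> : T * (sg * (d i).1 - e * (d i).2) =
      (sg * X (s i.+1) - e * Y (s i.+1)) - (sg * X (s i) - e * Y (s i)).
      have -> : X (s i.+1) = X (s i) + T * (d i).1 by lra.
      have -> : Y (s i.+1) = Y (s i) + T * (d i).2 by lra.
      ring.
    rewrite subr_ge0; apply: (@derive_ge0_le _ (fun x => sg * X x - e * Y x)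
       (fun x => sg * derive1 X x - e * derive1 Y x)).
    - exact/ltW/slt.
    - move=> x _; have ? := real_analytic_is_derive x aX; have ? := real_analytic_is_derive x aY.
      by apply: is_derive_eq; rewrite /GRing.scale /=; ring.
    - move=> x xs; have xr : - r <= x <= 0 by have := sr i; have := sr i.+1; lra.
      rewrite subr_ge0; apply: le_trans (ler_norm _) _; rewrite normrM e1 mul1r.
      apply: le_trans (ltW (Y'r x xr)) _; rewrite ler_pM2l//.
      by have := X'r x xr; lra.
  have h1 := dle 1 (normr1 _); have h2 := dle (-1) (normrN1 _).
  have d1le : (d i).1 <= 1.
    have : 0 <= (d i).2 * (d i).2 by rewrite -expr2 sqr_ge0.
    by move: d1; rewrite /dot => d1 y0; nra.
  have : sg * (d i).1 <= sg by rewrite ger_pMr.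
  by rewrite ler_norml; lra.
pose chi i := asin (d i).2.
have chiP i : [/\ `|chi i| <= 1 / 4, sin (chi i) = (d i).2 & cos (chi i) = (d i).1].
  have [h1 h2 h3] := small_angle (dsmall i); split=> //.
  have [d1 d10] := dunit i.
  rewrite /chi h3 (_ : 1 - _ = (d i).1 ^+ 2) ?sqrtr_sqr ?gtr0_norm//.
  by move: d1; rewrite /dot; lra.
apply: (@chords_contradiction R X Y psi (fun x => derive1 (derive1 Y) x / derive1 X x) r s chi).
- by move=> x /psiP[_ _ ->]; exact: real_analytic_is_derive.
- by move=> x /psiP[_ -> _]; exact: real_analytic_is_derive.
- move=> x xr; have [h1 h2 h3] := psiP x xr.
  have yb : -1 < derive1 Y x < 1.
    have := Y'r x xr; have := sin_le1 (1 / 4 : R); rewrite -/sg ltr_norml; lra.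
  have hc := is_derive1_comp (is_derive1_asin yb) (real_analytic_is_derive x aY').
  apply: (is_derive_eq hc).
  have -> : Num.sqrt (1 - derive1 Y x ^+ 2) = derive1 X x.
    rewrite -(unit x) addrK sqrtr_sqr ger0_norm//.
    by have := X'r x xr; lra.
  by rewrite mulrC.
- by move=> x /psiP[].
- by move=> i; have [] := chiP i.
- exact: sr.
- exact: slt.
- move=> i; have [c1 c2 c3] := chiP i; have [p1 p2' p3] := psiP _ (sr i.+1).
  have [c1' _ _] := chiP i.+1.
  (* The vector reflection law is the expansion of sin (2 psi - chi). Both angles are below 1 in
     absolute value, so sine can be cancelled. *)
  have e : sin (chi i.+1) = sin (2 * psi (s i.+1) - chi i).
    have [_ -> _] := chiP i.+1; rewrite refl -c2 -c3 -p2' -p3 sinB.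
    have -> : 2 * psi (s i.+1) = psi (s i.+1) + psi (s i.+1) by ring.
    rewrite sinD cosD.
    have := cos2Dsin2 (psi (s i.+1)); set C := cos (psi _); set S := sin (psi _) => CS.
    have -> : C * C - S * S = 1 - 2 * S ^+ 2 by lra.
    ring.
  suff : chi i.+1 = 2 * psi (s i.+1) - chi i by move->; ring.
  move: c1 p1 c1'; rewrite !ler_norml => /andP[? ?] /andP[? ?] /andP[? ?].
  by apply: sin_inj => //; rewrite in_itv /=; apply/andP; split; lra.
- move=> i; have [_ -> ->] := chiP i; have [T T0 [TX TY]] := chord i.
  have -> : X (s i.+1) = X (s i) + T * (d i).1 by lra.
  have -> : Y (s i.+1) = Y (s i) + T * (d i).2 by lra.
  ring.
- by move=> i x xs; have [_ -> ->] := chiP i; exact: below.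
- case: mono => mono; [left|right] => x y x1 xy y0; apply: mono => //; lra.
Qed.

(** * Plane geometry and outward normals *)

Section PlaneGeometry.
Context {R : realType}.
Implicit Types (u v w p q n : R * R) (A Omega : set (R * R)).

Lemma dot_ge0 u : 0 <= dot u u.
Proof. by rewrite /dot -!expr2 addr_ge0 ?sqr_ge0. Qed.

Lemma enorm_ge0 u : 0 <= enorm u. Proof. exact: sqrtr_ge0. Qed.

Lemma enorm_sqr u : enorm u ^+ 2 = dot u u.
Proof. by rewrite sqr_sqrtr// dot_ge0. Qed.

Lemma enorm_eq0 u : enorm u = 0 -> u = 0.
Proof.
move=> h; have := enorm_sqr u; rewrite h expr0n /= /dot -!expr2 => /esym/eqP.
by rewrite paddr_eq0 ?sqr_ge0// !sqrf_eq0 => /andP[/eqP a /eqP b]; case: u a b {h} => ? ? /= -> ->.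
Qed.

Lemma enorm_gt0 u : u != 0 -> 0 < enorm u.
Proof.
by move=> u0; rewrite lt_neqAle enorm_ge0 andbT eq_sym; apply: contra_neq u0; exact: enorm_eq0.
Qed.

Lemma enormZ (c : R) u : enorm (c *: u) = `|c| * enorm u.
Proof.
rewrite /enorm (_ : dot _ _ = c ^+ 2 * dot u u); last first.
  by rewrite /dot /= /GRing.scale /=; ring.
by rewrite sqrtrM ?sqr_ge0// sqrtr_sqr.
Qed.

Lemma norm_fst_le_enorm u : `|u.1| <= enorm u.
Proof.
rewrite -sqrtr_sqr ler_wsqrtr// /dot -!expr2 lerDl sqr_ge0//.
Qed.

Lemma norm_snd_le_enorm u : `|u.2| <= enorm u.
Proof.
rewrite -sqrtr_sqr ler_wsqrtr// /dot -!expr2 lerDr sqr_ge0//.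
Qed.

Lemma enorm_le_sum u : enorm u <= `|u.1| + `|u.2|.
Proof.
rewrite -[leRHS]ger0_norm ?addr_ge0// -sqrtr_sqr ler_wsqrtr//.
rewrite sqrrD !real_normK ?num_real// /dot -!expr2 lerD2r lerDl.
by rewrite mulrn_wge0// mulr_ge0.
Qed.

Lemma dot_le_enorm u v : dot u v <= enorm u * enorm v.
Proof.
apply: le_trans (ler_norm _) _.
rewrite -sqrtr_sqr -sqrtrM ?dot_ge0// ler_wsqrtr// -subr_ge0.
rewrite (_ : _ - _ = (u.1 * v.2 - u.2 * v.1) ^+ 2) ?sqr_ge0//.
by rewrite /dot; ring.
Qed.

Lemma dotC u v : dot u v = dot v u.
Proof. by rewrite /dot; ring. Qed.

Lemma dotDr u v w : dot u (v + w) = dot u v + dot u w.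
Proof. by rewrite /dot /=; ring. Qed.

Lemma dotNr u v : dot u (- v) = - dot u v.
Proof. by rewrite /dot /=; ring. Qed.

Lemma dotZr (c : R) u v : dot u (c *: v) = c * dot u v.
Proof. by rewrite /dot /= /GRing.scale /=; ring. Qed.

Lemma enormN u : enorm (- u) = enorm u.
Proof. by rewrite /enorm /dot /= !mulrNN. Qed.

Lemma enormD_le u v : enorm (u + v) <= enorm u + enorm v.
Proof.
rewrite -(@ler_pXn2r _ 2) ?nnegrE ?addr_ge0 ?enorm_ge0//.
rewrite sqrrD !enorm_sqr.
have := dot_le_enorm u v; rewrite /dot /= => h; lra.
Qed.

Lemma nbhs_enormP p (P : R * R -> Prop) :
  (\forall y \near p, P y) <->
  exists2 e : R, 0 < e & forall y, enorm (y - p) < e -> P y.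
Proof.
split=> [/nbhs_ballP[e /= e0 he]|[e e0 he]].
  exists e => // y ye; apply: he; split; rewrite /ball /= distrC.
    exact: le_lt_trans (norm_fst_le_enorm (y - p)) ye.
  exact: le_lt_trans (norm_snd_le_enorm (y - p)) ye.
apply/nbhs_ballP; exists (e / 2); first by rewrite /= divr_gt0.
move=> y [/= y1 y2]; apply: he; apply: le_lt_trans (enorm_le_sum _) _.
move: y1 y2; rewrite /ball /= distrC => y1; rewrite distrC => y2; lra.
Qed.

Lemma open_enorm Omega p : open Omega -> Omega p ->
  exists2 e : R, 0 < e & forall y, enorm (y - p) < e -> Omega y.
Proof. by rewrite openE => oO Op; apply/nbhs_enormP; exact: oO. Qed.

Lemma closure_enormP A p :
  closure A p <-> forall e : R, 0 < e -> exists2 y, A y & enorm (y - p) < e.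
Proof.
split=> [cA e e0|h B /nbhs_enormP[e e0 he]]; last first.
  by have [y Ay ye] := h e e0; exists y; split=> //; exact: he.
have /cA[y [Ay ye]] : nbhs p [set y | enorm (y - p) < e].
  by apply/nbhs_enormP; exists e.
by exists y.
Qed.

Lemma boundaryP Omega p : open Omega ->
  boundary Omega p <-> closure Omega p /\ ~ Omega p.
Proof.
by move=> oO; rewrite /boundary (interior_id _).1.
Qed.

Lemma closure_ray Omega p w (d : R) : 0 < d ->
  (forall t, 0 < t < d -> Omega (p + t *: w)) -> closure Omega p.
Proof.
move=> d0 h; apply/closure_enormP => e e0.
pose m := e / (enorm w + 1).
have w1 : 0 < enorm w + 1 by rewrite ltr_wpDl ?enorm_ge0.
have m0 : 0 < m by rewrite divr_gt0.
pose t := Num.min d m / 2.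
have mm0 : 0 < Num.min d m by rewrite lt_min d0.
have t0 : 0 < t by rewrite divr_gt0.
have : t < Num.min d m by rewrite /t; lra.
rewrite lt_min => /andP[td tm].
exists (p + t *: w); first by apply: h; rewrite t0.
rewrite addrAC subrr add0r enormZ gtr0_norm//.
have : t * (enorm w + 1) < e by rewrite -ltr_pdivlMr.
by have := enorm_ge0 w; nra.
Qed.

(** A ray transversal to the boundary stays in a cone where the normal condition decides membership:
    [eps] is taken slightly below |n . w| / |w|, the + 1 covering w = 0. *)
Lemma outward_normal_ray Omega p n w : is_outward_normal Omega p n ->
  exists2 d : R, 0 < d & forall t, 0 < t < d ->
   (dot n w < 0 -> Omega (p + t *: w)) /\ (0 < dot n w -> ~ Omega (p + t *: w)).
Proof.
move=> [n1 hn].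
have [w0|w0] := eqVneq (dot n w) 0; first by exists 1 => // t _; rewrite w0 ltxx.
have w1 : 0 < enorm w + 1 by rewrite ltr_wpDl ?enorm_ge0.
pose eps := `|dot n w| / (enorm w + 1).
have eps0 : 0 < eps by rewrite divr_gt0// normr_gt0.
have epsw : eps * enorm w < `|dot n w|.
  rewrite /eps mulrAC ltr_pdivrMr// ltr_pM2l ?normr_gt0//; lra.
have /nbhs_enormP[d d0 hd] := hn eps eps0.
exists (d / (enorm w + 1)); first by rewrite divr_gt0.
move=> t /andP[t0]; rewrite ltr_pdivlMr// => td.
have e : p + t *: w - p = t *: w by rewrite addrAC subrr add0r.
have hh : enorm (t *: w) < d by rewrite enormZ gtr0_norm//; have := enorm_ge0 w; nra.
have := hd (p + t *: w); rewrite e => /(_ hh)[h1 h2].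
split=> s; [apply: h1|apply: h2]; rewrite dotZr enormZ (gtr0_norm t0) mulrCA.
- by rewrite -mulrN ltr_pM2l// -ltr0_norm.
- by rewrite ltr_pM2l// -[ltRHS]gtr0_norm.
Qed.

(** In the direction n' - n, which has negative product with n and positive product with n', short
    steps from [p] would land both inside and outside [Omega]. *)
Lemma is_outward_normal_unique Omega p n n' :
  is_outward_normal Omega p n -> is_outward_normal Omega p n' -> n = n'.
Proof.
move=> hn hn'; have [n1 _] := hn; have [n1' _] := hn'.
apply/eqP; rewrite eq_sym -subr_eq0; apply/negP => /negP /enorm_gt0 h0.
have h : 0 < dot (n' - n) (n' - n) by rewrite -enorm_sqr exprn_gt0.
have := enorm_sqr n; have := enorm_sqr n'; rewrite n1 n1' expr1n => d' d.
have [e e0 he] := outward_normal_ray (n' - n) hn.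
have [e' e0' he'] := outward_normal_ray (n' - n) hn'.
have m0 : 0 < Num.min e e' by rewrite lt_min e0.
have : 0 < Num.min e e' / 2 < Num.min e e' by lra.
rewrite lt_min => /and3P[t0 t1 t2].
have /he[+ _] : 0 < Num.min e e' / 2 < e by rewrite t0.
have /he'[_ +] : 0 < Num.min e e' / 2 < e' by rewrite t0.
move: h d d'; rewrite /dot /= => h d d' h1 h2; exfalso; apply: h1; last apply: h2; lra.
Qed.

Lemma outward_normalE Omega p n : is_outward_normal Omega p n -> outward_normal Omega p = n.
Proof.
move=> hn; apply: (is_outward_normal_unique (Omega := Omega) (p := p)) => //.
exact: (@getI _ (is_outward_normal Omega p) n).
Qed.

(** Real induction: the infimum of the failures satisfies [P] by the closedness hypothesis, and
    openness then pushes the failures strictly beyond their infimum. *)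
Lemma line_fill (P : R -> Prop) (h1 h2 : R) :
  (exists2 e : R, 0 < e & forall x, h1 < x < h1 + e -> P x) ->
  (forall x, P x -> exists2 e : R, 0 < e & forall y : R, `|y - x| < e -> P y) ->
  (forall x, h1 < x <= h2 -> (forall y, h1 < y < x -> P y) -> P x) ->
  forall x, h1 < x <= h2 -> P x.
Proof.
move=> [e e0 he] hopen hclosed u0 /andP[u1 u2]; apply: contrapT => nP.
pose B := [set x | h1 < x <= h2 /\ ~ P x].
have B0 : B !=set0 by exists u0; split=> //; rewrite u1.
have lbB : lbound B (h1 + e).
  move=> w [/andP[w1 w2] nPw]; rewrite leNgt; apply/negP => we.
  by apply: nPw; apply: he; rewrite w1.
have hasB : has_inf B by split=> //; exists (h1 + e).
have mle : h1 + e <= inf B by exact: lb_le_inf.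
have mu : inf B <= u0 by apply: ge_inf; [case: hasB|split=> //; rewrite u1].
have Pw (w : R) : h1 < w < inf B -> P w.
  move=> /andP[w1 w2]; apply: contrapT => nPw.
  have : inf B <= w.
    by apply: ge_inf; [case: hasB|split=> //; rewrite w1/= (le_trans (ltW w2))// (le_trans mu)].
  by rewrite leNgt w2.
have Pm : P (inf B) by apply: hclosed => //; rewrite (le_trans mu u2) andbT; lra.
have [d d0 hd] := hopen _ Pm.
have : inf B + d <= inf B.
  apply: lb_le_inf => // w [/andP[w1 w2] nPw]; rewrite leNgt; apply/negP => wd.
  have wB : inf B <= w by apply: ge_inf; [case: hasB|split=> //; rewrite w1].
  by apply: nPw; apply: hd; rewrite ger0_norm ?subr_ge0//; lra.
by rewrite gerDl leNgt d0.
Qed.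

End PlaneGeometry.

Lemma real_analytic_cst {R : realType} (C : R) : real_analytic (fun _ => C).
Proof.
move=> t0; exists (fun n => C *+ (n == 0%N)), 1; split=> // t _.
rewrite -cvg_shiftS.
have -> : (fun n => pseries (fun n => C *+ (n == 0%N)) (t - t0) n.+1) = cst C; last exact: cvg_cst.
apply/funext => n; rewrite /pseries /series /= big_nat_recl// expr0 mulr1 mulr1n.
by rewrite big1 ?addr0// => i _; rewrite mul0r.
Qed.

Lemma derive1_periodic {R : realType} (f : R -> R) (T : R) :
  periodic f T -> periodic (derive1 f) T.
Proof.
move=> fT t; rewrite /derive1.
suff -> : (fun h => h^-1 *: (f (h + (t + T)) - f (t + T))) =
  (fun h => h^-1 *: (f (h + t) - f t)) by [].
by apply/funext => h; rewrite addrA !fT.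
Qed.

Lemma period_reduce {R : realType} (P : R -> Prop) (a b : R) : a < b ->
  (forall t, P t <-> P (t + (b - a))) -> (forall t, a <= t < b -> P t) -> forall t, P t.
Proof.
move=> ab per h t; have T0 : 0 < b - a by rewrite subr_gt0.
have perD n u : P u <-> P (u + (b - a) *+ n).
  elim: n => [|n IH]; first by rewrite mulr0n addr0.
  rewrite mulrSr addrA; apply: iff_trans IH _; exact: per.
pose n := Num.floor ((t - a) / (b - a)).
have hn : P (t - n%:~R * (b - a)).
  have := floor_itv ((t - a) / (b - a)); rewrite -/n => /andP[].
  rewrite ler_pdivlMr// ltr_pdivrMr// intrD mulrDl mul1r => n1 n2.
  by apply: h; apply/andP; split; lra.
case: (intP n) hn => [|m|m].
- by rewrite mul0r subr0.
- by move=> /(perD m.+1); rewrite -mulr_natl -pmulrn subrK.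
- move=> hn; apply/(perD m.+1); move: hn.
  by rewrite mulrNz mulNr opprK -mulr_natl -pmulrn.
Qed.

(** * Boundary curves *)

Section Domain.
Context {R : realType} (Omega : set (R * R)) (M : nat)
  (Om : 'I_M.+1 -> set (R * R)) (a b : 'I_M.+1 -> R)
  (alpha : 'I_M.+1 -> R -> R * R).
Hypothesis hOmega : analytic_nonconvex_domain Omega Om a b alpha.
Hypothesis halpha : arclength_outward Omega a b alpha.
Implicit Types (i j : 'I_M.+1) (p q w : R * R).

Let oO : open Omega := domain_open hOmega.

Lemma curve_analytic i : real_analytic (fun t => (alpha i t).1) /\
  real_analytic (fun t => (alpha i t).2).
Proof. by have [[_ _ ? _] _] := boundaries_curves hOmega i. Qed.

Lemma curve_periodic i : periodic (alpha i) (b i - a i).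
Proof. by have [[_ ? _ _] _] := boundaries_curves hOmega i. Qed.

Lemma curve_domain i : a i < b i.
Proof. by have [[? _ _ _] _] := boundaries_curves hOmega i. Qed.

Lemma curve_velocity_periodic i : periodic (curve_velocity (alpha i)) (b i - a i).
Proof.
move=> t; rewrite /curve_velocity; congr (_, _);
  by apply: derive1_periodic => u; rewrite curve_periodic.
Qed.

(** Periodicity carries the hypothesis to all parameters, so that every base parameter, endpoints
    included, has two-sided neighbourhoods to work in. *)
Lemma curve_outward i t : enorm (curve_velocity (alpha i) t) = 1 /\
  is_outward_normal Omega (alpha i t) (curve_normal (alpha i) t).
Proof.
apply: (period_reduce (curve_domain i)
  (P := fun t => enorm (curve_velocity (alpha i) t) = 1 /\
  is_outward_normal Omega (alpha i t) (curve_normal (alpha i) t))) => u.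
  by rewrite /curve_normal curve_velocity_periodic curve_periodic.
by move=> /andP[u1 u2]; apply: halpha; rewrite in_itv /= u1 ltW.
Qed.

Lemma boundary_param q : boundary Omega q ->
  exists i t, a i <= t < b i /\ q = alpha i t.
Proof.
rewrite (domain_boundary hOmega) => -[i _].
have [_ ->] := boundaries_curves hOmega i.
move=> [t /=]; rewrite in_itv /= => /andP[t1 t2] <-; exists i.
move: t2; rewrite le_eqVlt => /predU1P[->|t2]; last by exists t; rewrite t1.
exists (a i); rewrite lexx curve_domain; split=> //.
by rewrite -(curve_periodic i (a i)) addrC subrK.
Qed.

Lemma curve_boundary i t : boundary Omega (alpha i t).
Proof.
apply: (period_reduce (curve_domain i) (P := fun t => boundary Omega (alpha i t))) => u.
  by rewrite curve_periodic.
move=> /andP[u1 u2]; rewrite (domain_boundary hOmega); exists i => //.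
have [_ ->] := boundaries_curves hOmega i.
by exists u => //=; rewrite in_itv /= u1 ltW.
Qed.

Lemma boundary_normal q : boundary Omega q -> is_outward_normal Omega q (outward_normal Omega q).
Proof.
move=> /boundary_param[i [t [_ ->]]].
by have [_ h] := curve_outward i t; rewrite (outward_normalE h).
Qed.

Lemma boundary_outside q : boundary Omega q -> ~ Omega q.
Proof. by move=> /(boundaryP _ oO)[]. Qed.

Lemma curve_continuous i : continuous (alpha i).
Proof.
move=> t; have [f1 f2] := curve_analytic i.
have /cvgr_dist_lt c1 := real_analytic_continuous f1 (x := t).
have /cvgr_dist_lt c2 := real_analytic_continuous f2 (x := t).
apply/cvg_ballP => e e0; near=> u; split; rewrite /ball /=; near: u; [exact: c1|exact: c2].
Unshelve. all: by end_near. Qed.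

(** Other arcs might a priori approach [p] with a different normal. The parameters [C j] of normals
    in the wrong half-plane are compact, so their image is closed; it misses [p], whose only normal
    is [n0], and hence misses a neighbourhood of [p]. *)
Lemma normals_near i t0 : exists2 e : R, 0 < e &
  forall q, boundary Omega q -> enorm (q - alpha i t0) < e ->
  0 < dot (curve_normal (alpha i) t0) (outward_normal Omega q).
Proof.
set p := alpha i t0; set n0 := curve_normal (alpha i) t0.
have [T1 hn0] := curve_outward i t0; rewrite -/p -/n0 in hn0.
pose f j t := dot n0 (curve_normal (alpha j) t).
have cf j : continuous (f j).
  have [f1 f2] := curve_analytic j.
  have c1 := real_analytic_continuous (real_analytic_derive1 f1).
  have c2 := real_analytic_continuous (real_analytic_derive1 f2).
  move=> t; rewrite /f /dot /curve_normal /curve_velocity /=.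
  apply: cvgD; apply: cvgM; [exact: cvg_cst|exact: c2|exact: cvg_cst|].
  by apply: cvgN; exact: c1.
pose C j := `[a j, b j]%classic `&` [set t | f j t <= 0].
have cC j : compact (C j).
  apply: (@subclosed_compact _ _ `[a j, b j]%classic).
  - apply: closedI; first exact: itv_closed.
    rewrite [X in closed X](_ : _ = f j @^-1` [set x | x <= 0]); last by [].
    by apply: closed_comp; [move=> t _; exact: cf|exact: closed_le].
  - exact: segment_compact.
  - by move=> t [].
have clC j : closed (alpha j @` C j).
  apply: compact_closed; first exact: norm_hausdorff.
  apply: continuous_compact => //.
  by apply: continuous_subspaceT; exact: curve_continuous.
have near_j j : \forall q \near p, ~ (alpha j @` C j) q.
  have : open (~` (alpha j @` C j)) by rewrite openC.
  rewrite openE; apply => -[t [_ /= ft] e].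
  have [_ hn] := curve_outward j t; rewrite e in hn.
  move: ft; rewrite /f (is_outward_normal_unique hn hn0).
  rewrite -enorm_sqr; have [-> _] := hn0; rewrite expr1n.
  by rewrite leNgt ltr01.
have /nbhs_enormP[e e0 he] : \forall q \near p, forall j, ~ (alpha j @` C j) q 
  by apply: (@filter_forall _ _ (fun j q => ~ (alpha j @` C j) q) (nbhs p)) => //; exact: nbhs_filter.
exists e => // q bq qe; have [j [t [/andP[t1 t2] qt]]] := boundary_param bq.
have [_ hn] := curve_outward j t; rewrite qt (outward_normalE hn) ltNge.
apply/negP => h; apply: (he q qe j); exists t => //.
by split=> //=; rewrite in_itv /= t1 ltW.
Qed.

End Domain.

(** * Local coordinates at a boundary point *)

Section Frame.
Context {R : realType} (Omega : set (R * R)) (M : nat)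
  (Om : 'I_M.+1 -> set (R * R)) (a b : 'I_M.+1 -> R)
  (alpha : 'I_M.+1 -> R -> R * R).
Hypothesis hOmega : analytic_nonconvex_domain Omega Om a b alpha.
Hypothesis halpha : arclength_outward Omega a b alpha.
Variables (i : 'I_M.+1) (t0 : R).
Implicit Types (p q w : R * R).

Let oO : open Omega := domain_open hOmega.

(* Orthonormal coordinates at [alpha i t0]: abscissa along the tangent,
   ordinate along the inward normal. *)
Definition frame_x (alpha : 'I_M.+1 -> R -> R * R) i (t0 s : R) : R :=
  dot (curve_velocity (alpha i) t0) (alpha i (t0 + s) - alpha i t0).
Definition frame_y (alpha : 'I_M.+1 -> R -> R * R) i (t0 s : R) : R :=
  - dot (curve_normal (alpha i) t0) (alpha i (t0 + s) - alpha i t0).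

Let p := alpha i t0.
Let T := curve_velocity (alpha i) t0.
Let n0 := curve_normal (alpha i) t0.
Let X := frame_x alpha i t0.
Let Y := frame_y alpha i t0.

Let TT : T.1 * T.1 + T.2 * T.2 = 1.
Proof.
by have [h _] := curve_outward hOmega halpha i t0; have := enorm_sqr T; rewrite h expr1n.
Qed.

Let n0E : n0 = (T.2, - T.1). Proof. by []. Qed.

Lemma frame_decomposition w : w = dot T w *: T + dot n0 w *: n0.
Proof.
rewrite n0E /dot; case: w => w1 w2; move: T TT => [T1 T2] /= hT.
rewrite [RHS]surjective_pairing /=; congr (_, _); rewrite -![_ *: _]/(_ * _).
- transitivity ((T1 * T1 + T2 * T2) * w1); first by rewrite hT mul1r.
  ring.
- transitivity ((T1 * T1 + T2 * T2) * w2); first by rewrite hT mul1r.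
  ring.
Qed.

Lemma frame_analytic : real_analytic X /\ real_analytic Y.
Proof.
have [f1 f2] := curve_analytic hOmega i.
have g1 := real_analytic_shift t0 f1; have g2 := real_analytic_shift t0 f2.
have h c1 c2 c3 : real_analytic (fun s => c1 * (alpha i (t0 + s)).1 + c2 * (alpha i (t0 + s)).2 + c3).
  have := real_analytic_lincomb 1 1 (real_analytic_lincomb c1 c2 g1 g2) (real_analytic_cst c3).
  by congr real_analytic; apply/funext => s; ring.
split.
- have := h T.1 T.2 (- dot T p); congr real_analytic; apply/funext => s.
  by rewrite /X /frame_x -/T -/p /dot /=; ring.
- have := h (- n0.1) (- n0.2) (dot n0 p); congr real_analytic; apply/funext => s.
  by rewrite /Y /frame_y -/n0 -/p /dot /=; ring.
Qed.

Lemma frame_derive1 s :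
  derive1 X s = dot T (curve_velocity (alpha i) (t0 + s)) /\
  derive1 Y s = - dot n0 (curve_velocity (alpha i) (t0 + s)).
Proof.
have [f1 f2] := curve_analytic hOmega i.
have d1 := is_derive_shiftl (real_analytic_is_derive (t0 + s) f1).
have d2 := is_derive_shiftl (real_analytic_is_derive (t0 + s) f2).
have h c1 c2 c3 : derive1 (fun s => c1 * (alpha i (t0 + s)).1 + c2 * (alpha i (t0 + s)).2 + c3) s =
   c1 * derive1 (fun t => (alpha i t).1) (t0 + s) + c2 * derive1 (fun t => (alpha i t).2) (t0 + s).
  by rewrite derive1E; apply: derive_val; apply: is_derive_eq; rewrite /GRing.scale /=; ring.
split.
- transitivity (derive1 (fun s => T.1 * (alpha i (t0 + s)).1 + T.2 * (alpha i (t0 + s)).2 - dot T p) s).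
    by congr (derive1 _ s); apply/funext => u; rewrite /X /frame_x -/T -/p /dot /=; ring.
  by rewrite h.
- transitivity (derive1 (fun s => (- n0.1) * (alpha i (t0 + s)).1 + (- n0.2) * (alpha i (t0 + s)).2 + dot n0 p) s).
    by congr (derive1 _ s); apply/funext => u; rewrite /Y /frame_y -/n0 -/p /dot /=; ring.
  by rewrite h /dot /curve_velocity /=; ring.
Qed.

Lemma frame_derive2 s :
  derive1 (derive1 Y) s = - dot n0 (curve_acceleration (alpha i) (t0 + s)).
Proof.
have [f1 f2] := curve_analytic hOmega i.
have d1 := is_derive_shiftl (real_analytic_is_derive (t0 + s) (real_analytic_derive1 f1)).
have d2 := is_derive_shiftl (real_analytic_is_derive (t0 + s) (real_analytic_derive1 f2)).
rewrite (_ : derive1 Y = fun s => - n0.1 * derive1 (fun t => (alpha i t).1) (t0 + s)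
   + - n0.2 * derive1 (fun t => (alpha i t).2) (t0 + s)).
  rewrite derive1E; apply: derive_val; apply: is_derive_eq.
  by rewrite /dot /curve_acceleration /GRing.scale /=; ring.
by apply/funext => u; have [_ ->] := frame_derive1 u; rewrite /dot /curve_velocity /=; ring.
Qed.

Lemma frame_unit s : derive1 X s ^+ 2 + derive1 Y s ^+ 2 = 1.
Proof.
have [-> ->] := frame_derive1 s.
have [h _] := curve_outward hOmega halpha i (t0 + s).
have := enorm_sqr (curve_velocity (alpha i) (t0 + s)); rewrite h expr1n n0E.
set V := curve_velocity _ _ => e.
transitivity ((T.1 * T.1 + T.2 * T.2) * dot V V); last by rewrite TT -e mul1r.
by rewrite /dot /=; ring.
Qed.

Lemma frame_origin : [/\ X 0 = 0, Y 0 = 0, derive1 X 0 = 1 & derive1 Y 0 = 0].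
Proof.
have [hx hy] := frame_derive1 0; rewrite hx hy addr0 -/T; split.
- by rewrite /X /frame_x addr0 subrr /dot /= !mulr0 addr0.
- by rewrite /Y /frame_y addr0 subrr /dot /= !mulr0 addr0 oppr0.
- exact: TT.
- by rewrite n0E /dot /=; ring.
Qed.

Lemma frame_normal s :
  dot T (curve_normal (alpha i) (t0 + s)) = derive1 Y s /\
  dot n0 (curve_normal (alpha i) (t0 + s)) = derive1 X s.
Proof.
have [-> ->] := frame_derive1 s; by rewrite /n0 /T /dot /curve_normal /=; split; ring.
Qed.

(** The minus sign appears because ordinates are measured along the inward normal and curvature
    along the outward one. The formula is exact away from s = 0 because at unit speed the
    acceleration is orthogonal to the velocity. *)
Lemma frame_curvature s :
  curvature (alpha i) (t0 + s) * derive1 X s = - derive1 (derive1 Y) s.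
Proof.
rewrite frame_derive2 opprK; have [_ <-] := frame_normal s.
set V := curve_velocity (alpha i) (t0 + s); set A := curve_acceleration (alpha i) (t0 + s).
have [f1 f2] := curve_analytic hOmega i.
have unitV u : derive1 (fun t => (alpha i t).1) u ^+ 2 + derive1 (fun t => (alpha i t).2) u ^+ 2 = 1.
  have [h _] := curve_outward hOmega halpha i u.
  by have := enorm_sqr (curve_velocity (alpha i) u); rewrite h expr1n /dot -!expr2.
have VA : V.1 * A.1 + V.2 * A.2 = 0.
  have d1 := real_analytic_is_derive (t0 + s) (real_analytic_derive1 f1).
  have d2 := real_analytic_is_derive (t0 + s) (real_analytic_derive1 f2).
  have e : derive1 (fun u => derive1 (fun t => (alpha i t).1) u * derive1 (fun t => (alpha i t).1) u
     + derive1 (fun t => (alpha i t).2) u * derive1 (fun t => (alpha i t).2) u) (t0 + s) =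
     2 * (V.1 * A.1 + V.2 * A.2).
    rewrite derive1E; apply: derive_val; apply: is_derive_eq.
    by rewrite /V /A /curve_acceleration /curve_velocity /GRing.scale /=; ring.
  move: e; rewrite (_ : (fun u => _) = cst 1); last first.
    by apply/funext => u; rewrite -!expr2 unitV.
  by rewrite derive1_cst => /esym/eqP; rewrite mulf_eq0 pnatr_eq0 /= => /eqP.
have VV : V.1 * V.1 + V.2 * V.2 = 1 by have := unitV (t0 + s); rewrite !expr2.
rewrite /curvature /curve_normal -/V -/A n0E.
move: T V A VV VA => [T1 T2] [V1 V2] [A1 A2]; rewrite /dot /= => VV VA.
transitivity ((V1 * V1 + V2 * V2) * (T2 * A1 - T1 * A2)
  + (V1 * A1 + V2 * A2) * (T1 * V2 - T2 * V1)); first by ring.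
by rewrite VV VA; ring.
Qed.

Let enorm_n0 : enorm n0 = 1.
Proof. by have [_ []] := curve_outward hOmega halpha i t0. Qed.

(* A ray along the inward normal [- n0] that leaves [Omega] near [p] would do so
   at a boundary point whose outward normal is far from [n0]. *)
Lemma vertical_fill : exists2 e : R, 0 < e & forall q (h : R), 0 < h ->
  enorm (q - p) + h < e ->
  (exists2 d : R, 0 < d & forall u, 0 < u < d -> Omega (q - u *: n0)) ->
  forall u, 0 < u <= h -> Omega (q - u *: n0).
Proof.
have [e e0 he] := normals_near hOmega halpha i t0; exists e => // q h h0 qe [d d0 hd].
apply: line_fill.
- by exists d => // x; rewrite add0r => /hd.
- move=> x /(open_enorm oO)[r r0 hr]; exists r => // y yx; apply: hr.
  by rewrite opprD opprK addrACA subrr add0r addrC -scalerBl enormZ enorm_n0 mulr1 distrC.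
- move=> x /andP[x0 xh] hx; apply: contrapT => nO.
  have cl : closure Omega (q - x *: n0).
    apply: (closure_ray (w := n0) x0) => t /andP[t0' tx].
    rewrite -addrA -scaleNr -scalerDl (_ : - x + t = - (x - t)) ?scaleNr; last by ring.
    by apply: hx; apply/andP; split; lra.
  have bq : boundary Omega (q - x *: n0) by apply/(boundaryP _ oO).
  have hn := boundary_normal hOmega halpha bq.
  have n0n : 0 < dot (outward_normal Omega (q - x *: n0)) n0.
    rewrite dotC; apply: he => //; apply: le_lt_trans qe.
    rewrite addrAC; apply: le_trans (enormD_le _ _) _; rewrite lerD2l enormN enormZ enorm_n0 mulr1.
    by rewrite gtr0_norm.
  have [r r0 hr] := outward_normal_ray n0 hn.
  have m0 : 0 < Num.min r x by rewrite lt_min r0.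
  have : 0 < Num.min r x / 2 < Num.min r x by lra.
  rewrite lt_min => /and3P[t0' t1 t2].
  have /hr[_ /(_ n0n)] : 0 < Num.min r x / 2 < r by rewrite t0'.
  apply; rewrite -addrA -scaleNr -scalerDl (_ : - x + _ = - (x - Num.min r x / 2)) ?scaleNr; last by ring.
  by apply: hx; apply/andP; split; lra.
Qed.

(** Near [p] the domain is the strict epigraph of this arc, and no other piece of boundary comes
    near. Above an arc point the inward ray starts inside and [vertical_fill] keeps it there. A
    point of [Omega] or of its boundary below the arc would start a filled ray through the arc
    itself, whose points are outside the open set [Omega]. *)
Lemma local_chart : exists2 e : R, 0 < e & forall q s, enorm (q - p) < e -> `|s| < e ->
  X s = dot T (q - p) ->
  (Y s < - dot n0 (q - p) -> Omega q) /\
  (- dot n0 (q - p) < Y s -> ~ Omega q /\ ~ boundary Omega q).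
Proof.
have [e1 e10 he1] := vertical_fill; have [e2 e20 normal_e2] := normals_near hOmega halpha i t0.
pose e := Num.min e1 e2; have e0 : 0 < e by rewrite lt_min e10.
have [le1 le2] : e <= e1 /\ e <= e2 by rewrite /e !ge_min !lexx orbT.
have he q h h0 (qh : enorm (q - p) + h < e) := he1 q h h0 (lt_le_trans qh le1).
have normal_E q bq (qe : enorm (q - p) < e) := normal_e2 q bq (lt_le_trans qe le2).
have /nbhs_enormP[d d0 hd] : \forall q \near p, enorm (q - p) < e / 4.
  by apply/nbhs_enormP; exists (e / 4) => //; lra.
have : \forall t \near t0, enorm (alpha i t - p) < e / 4.
  have cc := @curve_continuous _ _ _ _ _ _ _ hOmega i t0.
  apply: (cc [set y | enorm (y - p) < e / 4]); apply/nbhs_enormP.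
  by exists (e / 4) => //; lra.
move=> /nbhs_ballP[r /= r0 hr].
exists (Num.min r (e / 4)); first by rewrite lt_min r0 divr_gt0.
move=> q s; rewrite !lt_min => /andP[_ qe] /andP[sr _] Xs.
set g := alpha i (t0 + s).
have ge : enorm (g - p) < e / 4.
  by apply: hr; rewrite /ball /= opprD addrA subrr add0r normrN.
have bg : boundary Omega g by exact: curve_boundary hOmega _ _.
(* The signed height of [q] over the arc point [g] with the same abscissa. Since both are within e /
   4 of [p], |h| < e / 2 and the filled segments stay within the reach [e]. *)
pose h := - dot n0 (q - p) - Y s.
have qg : q = g - h *: n0.
  have E1 : q - p - (g - p) = dot n0 (q - p - (g - p)) *: n0.
    rewrite [LHS](frame_decomposition (q - p - (g - p))) dotDr dotNr -Xs.
    by rewrite /X /frame_x -/p -/T -/g subrr scale0r add0r.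
  have E2 : dot n0 (q - p - (g - p)) = - h.
    by rewrite dotDr dotNr /h /Y /frame_y -/n0 -/p -/g; ring.
  move: E1; rewrite E2 scaleNr opprB addrA subrK => e3.
  by rewrite -e3 addrCA subrr addr0.
have hh : `|h| < e / 2.
  have <- : enorm (q - g) = `|h|.
    by rewrite qg addrAC subrr add0r enormN enormZ enorm_n0 mulr1.
  rewrite (_ : q - g = (q - p) - (g - p)); last by rewrite opprB addrA subrK.
  by apply: le_lt_trans (enormD_le _ _) _; rewrite enormN; lra.
split=> hY.
- have h0 : 0 < h by rewrite /h; lra.
  rewrite qg; apply: (he g h h0) => //; last by rewrite h0 lexx.
    by rewrite gtr0_norm// in hh; lra.
  have [_ hn] := curve_outward hOmega halpha i (t0 + s); rewrite -/g in hn.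
  have gn0 : dot (curve_normal (alpha i) (t0 + s)) (- n0) < 0.
    rewrite dotNr dotC oppr_lt0 -(outward_normalE hn); apply: normal_E => //; lra.
  have [r1 r10 hr1] := outward_normal_ray (- n0) hn; exists r1 => // u /hr1[/(_ gn0)].
  by rewrite scalerN.
- have h0 : 0 < - h by rewrite /h; lra.
  have hh' : enorm (q - p) - h < e.
    have := enormD_le (q - g) (g - p); rewrite addrA subrK.
    have -> : enorm (q - g) = `|h|.
      by rewrite qg addrAC subrr add0r enormN enormZ enorm_n0 mulr1.
    by move: hh; rewrite ltr0_norm -?oppr_gt0//; lra.
  (* Both cases reduce to this: an inward ray from [q] that starts in [Omega] would, after length -
     h, put [g] in [Omega]. *)
  suff no r' : 0 < r' -> ~ (forall u, 0 < u < r' -> Omega (q - u *: n0)).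
    split=> [Oq|bq].
      have [r1 r10 hr1] := open_enorm oO Oq; apply: (no r1 r10) => u /andP[u0 ur].
      by apply: hr1; rewrite addrAC subrr add0r enormN enormZ enorm_n0 mulr1 gtr0_norm.
    have hn := boundary_normal hOmega halpha bq.
    have gn0 : dot (outward_normal Omega q) (- n0) < 0.
      rewrite dotNr dotC oppr_lt0; apply: normal_E => //; lra.
    have [r1 r10 hr1] := outward_normal_ray (- n0) hn.
    by apply: (no r1 r10) => u /hr1[/(_ gn0)]; rewrite scalerN.
  move=> r'0 hd0; apply: (boundary_outside hOmega bg).
  rewrite (_ : g = q - (- h) *: n0); last by rewrite qg scaleNr opprK subrK.
  by apply: (he q (- h) h0) => //; [exists r'|rewrite h0 lexx].
Qed.

Lemma frame_x_steep : exists2 r : R, 0 < r & forall s, `|s| <= r -> 1 / 2 < derive1 X s.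
Proof.
have [aX _] := frame_analytic; have [_ _ X'0 _] := frame_origin.
have c := real_analytic_continuous (real_analytic_derive1 aX) (x := 0).
have [d d0 hd] := continuous_dist c (divr_gt0 ltr01 (ltr0Sn R 1)).
exists (d / 2) => [|s sd]; first by rewrite divr_gt0.
have /hd : `|s| < d by lra.
by rewrite add0r X'0 ltr_norml => /andP[? _]; lra.
Qed.

Lemma frame_x_onto (eta : R) : 0 < eta ->
  exists2 e : R, 0 < e & forall x, `|x| < e -> exists2 s, `|s| < eta & X s = x.
Proof.
move=> eta0; have [r r0 hr] := frame_x_steep.
have [aX _] := frame_analytic; have [X0 _ _ _] := frame_origin.
pose m := Num.min eta r / 2.
have mm0 : 0 < Num.min eta r by rewrite lt_min eta0.
have m0 : 0 < m by rewrite divr_gt0.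
have : m < Num.min eta r by rewrite /m; lra.
rewrite lt_min => /andP[meta mr].
have mono x y : - m <= x -> x < y -> y <= m -> X x < X y.
  move=> x1 xy y1; apply: (@derive_gt0_lt _ X (derive1 X)) => //.
    by move=> z _; exact: real_analytic_is_derive.
  move=> z /andP[xz zy]; have : 1 / 2 < derive1 X z; last by lra.
  by apply: hr; rewrite ler_norml; apply/andP; split; lra.
have Xm : 0 < X m by rewrite -X0; apply: mono => //; lra.
have XNm : X (- m) < 0 by rewrite -X0; apply: mono => //; lra.
exists (Num.min (X m) (- X (- m))); first by rewrite lt_min Xm oppr_gt0.
move=> x; rewrite lt_min !ltr_norml => /andP[/andP[x1 x2] /andP[x3 x4]].
have [] := @IVT R X (- m) m x.
- lra.
- by apply: continuous_subspaceT; exact: real_analytic_continuous.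
- by rewrite ge_min le_max; apply/andP; split; apply/orP; [left|right]; lra.
move=> s; rewrite in_itv /= => /andP[s1 s2] Xs; exists s => //.
by rewrite ltr_norml; apply/andP; split; lra.
Qed.

Lemma norm_frame_x_le q : `|dot T (q - p)| <= enorm (q - p).
Proof.
have T1 : enorm T = 1 by have [] := curve_outward hOmega halpha i t0.
rewrite ler_norml; apply/andP; split; last first.
  by have := dot_le_enorm T (q - p); rewrite T1 mul1r.
by have := dot_le_enorm T (- (q - p)); rewrite T1 mul1r enormN dotNr; lra.
Qed.

(** A boundary point near [p] is neither above nor below the arc, hence on it. This is what places
    all late bounces on one arc. *)
Lemma boundary_chart (eta : R) : 0 < eta ->
  exists2 e : R, 0 < e & forall q, boundary Omega q -> enorm (q - p) < e ->
    exists2 s, `|s| < eta & q = alpha i (t0 + s).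
Proof.
move=> eta0; have [e e0 he] := local_chart.
have [d d0 hd] := frame_x_onto (eta := Num.min eta e) ltac:(by rewrite lt_min eta0).
exists (Num.min d e); first by rewrite lt_min d0.
move=> q bq; rewrite lt_min => /andP[qd qe].
have [s] := hd _ (le_lt_trans (norm_frame_x_le q) qd).
rewrite lt_min => /andP[seta se] Xs; exists s => //.
have [h1 h2] := he q s qe se Xs.
have Ys : Y s = - dot n0 (q - p).
  apply/eqP; rewrite eq_le !leNgt; apply/andP; split; apply/negP.
    by move=> /h2[_].
  by move=> /h1; exact: (boundary_outside hOmega bq).
apply: (subIr p); rewrite [LHS](frame_decomposition (q - p)).
rewrite [RHS](frame_decomposition (alpha i (t0 + s) - p)).
by rewrite -Xs -[dot n0 (q - p)]opprK -Ys /X /Y /frame_x /frame_y opprK.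
Qed.

End Frame.

(** * Inflection points *)

Section ConcaveIntervals.
Context {R : realType}.
Implicit Types (s : seq (R * R)) (S : set R) (kappa : R -> R).

(* Disjoint closed intervals, listed from right to left. *)
Definition interval_list s :=
  sorted (fun x y : R * R => y.2 < x.1) s && all (fun x : R * R => x.1 <= x.2) s.
Definition union_of s : set R := [set t | has (fun x : R * R => x.1 <= t <= x.2) s].
Definition interval_union S := exists2 s, interval_list s & S = union_of s.

(** A sweep to the right only touches the head of the list. Consecutive intervals must be strictly
    separated, so a new interval starting where the head ends is merged with it. *)
Lemma interval_union_extend S (c d : R) : c <= d -> (forall t, S t -> t <= c) ->
  interval_union S -> interval_union (S `|` `[c, d]%classic).
Proof.
move=> cd Sc [[|[l r] s] /andP[srt al] SE].
  exists [:: (c, d)]; first by rewrite /interval_list /= cd.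
  apply/seteqP; split=> t /=; rewrite SE /union_of /= in_itv /= orbF; last by right.
  by case.
move: al => /= /andP[lr als].
have rc : r <= c by apply: Sc; rewrite SE /union_of /= lr lexx.
move: rc; rewrite le_eqVlt => /predU1P[rc|rc].
  exists ((l, d) :: s).
    apply/andP; split; last by rewrite /= als (le_trans lr)// rc.
    by case: s srt {als SE} => //= x s /andP[-> ->].
  apply/seteqP; split=> t /=; rewrite SE /union_of /= in_itv /=.
    case=> [/orP[/andP[-> tr]|->]|/andP[ct ->]]; rewrite ?orbT//=.
      by rewrite (le_trans tr)// rc.
    by rewrite (le_trans lr)// rc.
  move=> /orP[/andP[lt td]|->]; last by left; rewrite orbT.
  have [tr|rt] := leP t r; first by left; rewrite lt.
  by right; rewrite td -rc ltW.
exists ((c, d) :: (l, r) :: s).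
  by apply/andP; split; rewrite /= ?rc//= ?cd ?lr.
apply/seteqP; split=> t /=; rewrite SE /union_of /= in_itv /=.
  by case=> ->; rewrite ?orbT.
by move=> /orP[|] h; [right|left].
Qed.

Lemma interval_unionP S : interval_union S ->
  exists (K : nat) (l r : 'I_K -> R),
  [/\ forall j, l j <= r j,
      forall j k, j != k -> `[l j, r j] `&` `[l k, r k] = set0 &
      S = \bigcup_j `[l j, r j]%classic].
Proof.
move=> [s /andP[srt al] ->].
pose x0 : R * R := (0, 0).
exists (size s), (fun j => (nth x0 s j).1), (fun j => (nth x0 s j).2).
have alj j : (j < size s)%N -> (nth x0 s j).1 <= (nth x0 s j).2.
  by move=> js; apply: (allP al); exact: mem_nth.
have lt_nth j k : (j < k < size s)%N -> (nth x0 s k).2 < (nth x0 s j).1.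
  move=> /andP[jk ks]; elim: k jk ks => // k IH; rewrite ltnS leq_eqVlt => jk ks.
  have step : (nth x0 s k.+1).2 < (nth x0 s k).1.
    by have /(sortedP x0) := srt; apply.
  case/predU1P: jk => [->//|jk].
  apply: lt_trans (IH jk (ltnW ks)); apply: lt_le_trans step _.
  by apply: alj; exact: ltnW.
split=> [j|j k jk|]; first by apply: alj.
  rewrite -subset0 => t []; rewrite /= !in_itv /= => /andP[j1 j2] /andP[k1 k2].
  have : (j != k :> nat) by [].
  rewrite neq_ltn => /orP[jk'|kj'].
    have := lt_nth j k; rewrite jk' ltn_ord => /(_ isT) h.
    by have := le_lt_trans k2 (lt_le_trans h j1); rewrite ltxx.
  have := lt_nth k j; rewrite kj' ltn_ord => /(_ isT) h.
  by have := le_lt_trans j2 (lt_le_trans h k1); rewrite ltxx.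
apply/seteqP; split=> t; rewrite /union_of /=.
  move=> /(hasP)[x xs tx]; have xi : (index x s < size s)%N by rewrite index_mem.
  by exists (Ordinal xi) => //=; rewrite nth_index// in_itv.
move=> [j _]; rewrite /= in_itv /= => tj; apply/hasP.
by exists (nth x0 s j) => //; exact: mem_nth.
Qed.

Lemma closure_itv_oo (c d : R) : c < d -> `[c, d]%classic `<=` closure `]c, d[%classic.
Proof.
move=> cd t; rewrite /= in_itv /= => /andP[ct td] B /nbhs_ballP[e /= e0 he].
have [tc|tc] := leP t ((c + d) / 2).
  pose m := Num.min e (d - c) / 2.
  have m0 : 0 < Num.min e (d - c) by rewrite lt_min e0 subr_gt0.
  have : 0 < m < Num.min e (d - c) by rewrite /m; lra.
  rewrite lt_min => /and3P[m1 m2 m3]; exists (t + m / 2); split.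
    by rewrite /= in_itv /=; apply/andP; split; lra.
  by apply: he; rewrite /ball /= opprD addrA subrr add0r normrN gtr0_norm; lra.
pose m := Num.min e (d - c) / 2.
have m0 : 0 < Num.min e (d - c) by rewrite lt_min e0 subr_gt0.
have : 0 < m < Num.min e (d - c) by rewrite /m; lra.
rewrite lt_min => /and3P[m1 m2 m3]; exists (t - m / 2); split.
  by rewrite /= in_itv /=; apply/andP; split; lra.
by apply: he; rewrite /ball /= opprB addrC subrK gtr0_norm; lra.
Qed.

(** Real induction on the right end of the window: a stretch where [kappa] is positive adds one
    closed interval, a nonpositive one leaves the closure unchanged. One-sided constant signs at
    every point let [line_fill] reach [b] with a finite list. *)
Lemma positive_set_intervals (a b : R) kappa : a <= b -> continuous kappa ->
  (forall t, exists2 d : R, 0 < d & (forall h, 0 < h < d -> 0 < kappa (t + h)) \/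
                                   (forall h, 0 < h < d -> kappa (t + h) <= 0)) ->
  (forall t, exists2 d : R, 0 < d & (forall h, 0 < h < d -> 0 < kappa (t - h)) \/
                                   (forall h, 0 < h < d -> kappa (t - h) <= 0)) ->
  interval_union (closure [set t | a <= t <= b /\ 0 < kappa t]).
Proof.
move=> ab ck sgr sgl.
pose A (c : R) := [set t | a <= t <= c /\ 0 < kappa t].
pose P c := interval_union (closure (A c)).
have step_pos (c d : R) : a <= c -> c < d -> (forall t, c < t < d -> 0 < kappa t) -> P c -> P d.
  move=> ac cd pos Pc.
  have AE : closure (A d) = closure (A c) `|` `[c, d]%classic.
    apply/seteqP; split.
      have cl : closed (closure (A c) `|` `[c, d]%classic).
        by apply: closedU; [exact: closed_closure|exact: itv_closed].
      apply: subset_trans cl; apply: closure_subset => t [/andP[t1 t2] kt].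
      have [tc|ct] := leP t c; first by left; apply: subset_closure; rewrite /A /= t1.
      by right; rewrite /= in_itv /= t2 ltW.
    move=> t [|]; first by apply: closure_subset => u [/andP[u1 u2] ku]; split=> //; rewrite u1 (le_trans u2)// ltW.
    move=> /(closure_itv_oo cd); apply: closure_subset => u; rewrite /= in_itv /= => /andP[u1 u2].
    by split; [rewrite (le_trans ac (ltW u1)) ltW|apply: pos; rewrite u1].
  rewrite /P AE; apply: interval_union_extend Pc; first exact: ltW.
  move=> t; suff : closure (A c) `<=` [set u | u <= c] by apply.
  have cl : closed [set u | u <= c] by exact: closed_le.
  by apply: subset_trans cl; apply: closure_subset => u [/andP[]].
have step_neg (c d : R) : a <= c -> c < d -> (forall t, c < t < d -> kappa t <= 0) -> P c -> P d.
  move=> ac cd neg; rewrite /P (_ : A d = A c)//.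
  apply/seteqP; split=> t [/andP[t1 t2] kt]; split=> //; rewrite t1/=; last by rewrite (le_trans t2)// ltW.
  rewrite leNgt; apply/negP => ct.
  move: t2; rewrite le_eqVlt => /predU1P[td|td]; last first.
    by have := neg t; rewrite ct td => /(_ isT); rewrite leNgt kt.
  (* Only t = d is left; a positive value there would by continuity spread to the left, into the
     nonpositive stretch. *)
  have [e e0 he] := continuous_dist (ck t) kt.
  pose m := Num.min e (d - c) / 2.
  have m0 : 0 < Num.min e (d - c) by rewrite lt_min e0 subr_gt0.
  have : 0 < m < Num.min e (d - c) by rewrite /m; lra.
  rewrite lt_min => /and3P[m1 m2 m3].
  have := he (- m); rewrite normrN gtr0_norm// => /(_ m2); rewrite ltr_norml => /andP[h _].
  by have := neg (t - m) ltac:(lra); lra.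
(* The window reduced to [a] yields the degenerate interval [a, a] or nothing. *)
have Pa : P a.
  rewrite /P; have [ka|ka] := ltP 0 (kappa a).
    rewrite (_ : A a = [set a]); last first.
      apply/seteqP; split=> t /=; first by case=> /andP[? ?] _; apply: le_anti; apply/andP.
      by move=> ->; rewrite /A /= lexx.
    exists [:: (a, a)]; first by rewrite /interval_list /= lexx.
    have /closure_id <- : closed [set a] by exact: closed_eq.
    apply/seteqP; split=> t; rewrite /union_of /= orbF; first by move=> ->; rewrite lexx.
    by move=> ?; apply: le_anti; rewrite andbC.
  rewrite (_ : A a = set0); last first.
    rewrite -subset0 => t [/andP[t1 t2]]; have -> : t = a by apply: le_anti; rewrite t1 t2.
    by rewrite ltNge ka.
  by exists [::] => //; rewrite closure0; apply/seteqP; split=> t.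
(* The hereditary form of [P]: openness to the left is then automatic, and only extension to the
   right must be proved. *)
pose Q x := forall y, a <= y <= x -> P y.
have right_ext x : a <= x -> Q x -> exists2 e : R, 0 < e & forall y, y < x + e -> Q y.
  move=> ax Qx; have [d d0 hd] := sgr x; exists d => // y yx z /andP[az zy].
  have [zx|xz] := leP z x; first by apply: Qx; rewrite az.
  have zt t : x < t < z -> 0 < t - x < d by lra.
  have Px : P x by apply: Qx; rewrite ax lexx.
  case: hd => hd; [apply: (step_pos x)|apply: (step_neg x)] => // t /zt /hd;
    by rewrite addrC subrK.
have Qa : Q a by move=> y /andP[y1 y2]; have -> : y = a by apply: le_anti; rewrite y1 y2.
move: ab; rewrite le_eqVlt => /predU1P[<-//|ab].
suff : Q b by apply; rewrite lexx ltW.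
apply: (@line_fill _ Q a b); last by rewrite ab lexx.
- have [e e0 he] := right_ext a (lexx _) Qa; exists e => // x /andP[_ xe]; exact: he.
- move=> x Qx; have [ax|xa] := leP a x.
    have [e e0 he] := right_ext x ax Qx; exists e => // y; rewrite ltr_norml => /andP[_ yx].
    by apply: he; lra.
  exists (a - x); first by rewrite subr_gt0.
  by move=> y; rewrite ltr_norml => /andP[_ yx] z /andP[az zy]; lra.
- move=> x /andP[ax xb] hQ y /andP[ay]; rewrite le_eqVlt => /predU1P[->|yx]; last first.
    move: ay; rewrite le_eqVlt => /predU1P[<-//|ay].
    by apply: (hQ y); rewrite ?ay ?yx// ltW//= lexx.
  have [d d0 hd] := sgl x.
  pose c := Num.max a (x - d / 2).
  have ac : a <= c by rewrite le_max lexx.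
  have cx : c < x by rewrite gt_max ax /=; lra.
  have Pc : P c.
    move: (ac); rewrite le_eqVlt => /predU1P[<-//|ac'].
    by apply: (hQ c); rewrite ?ac' ?cx// ac lexx.
  have dc : x - d / 2 <= c by rewrite le_max lexx orbT.
  have zt t : c < t < x -> 0 < x - t < d by lra.
  case: hd => hd; [apply: (step_pos c)|apply: (step_neg c)] => // t /zt /hd;
    by rewrite opprB addrC subrK.
Qed.

End ConcaveIntervals.


(** * Sign changes of the curvature are inflection points *)

Section Inflection.
Context {R : realType} (Omega : set (R * R)) (M : nat)
  (Om : 'I_M.+1 -> set (R * R)) (a b : 'I_M.+1 -> R)
  (alpha : 'I_M.+1 -> R -> R * R).
Hypothesis hOmega : analytic_nonconvex_domain Omega Om a b alpha.
Hypothesis halpha : arclength_outward Omega a b alpha.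
Variable i : 'I_M.+1.

Let kappa := curvature (alpha i).

Lemma curvature_periodic : periodic kappa (b i - a i).
Proof.
have per (f : R -> R) : periodic f (b i - a i) -> periodic (derive1n 2 f) (b i - a i).
  by move=> fT; apply/derive1_periodic/derive1_periodic.
have acc t : curve_acceleration (alpha i) (t + (b i - a i)) = curve_acceleration (alpha i) t.
  have p1 := per (fun s => (alpha i s).1) (fun u => congr1 fst (curve_periodic hOmega i u)).
  have p2 := per (fun s => (alpha i s).2) (fun u => congr1 snd (curve_periodic hOmega i u)).
  by rewrite /curve_acceleration p1 p2.
by move=> t; rewrite /kappa /curvature /curve_normal (curve_velocity_periodic hOmega) acc.
Qed.

Lemma curvature_continuous : continuous kappa.
Proof.
have [f1 f2] := curve_analytic hOmega i.
have c1 := real_analytic_continuous (real_analytic_derive1 f1).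
have c2 := real_analytic_continuous (real_analytic_derive1 f2).
have cc1 := real_analytic_continuous (real_analytic_derive1 (real_analytic_derive1 f1)).
have cc2 := real_analytic_continuous (real_analytic_derive1 (real_analytic_derive1 f2)).
move=> t; rewrite /kappa /curvature /dot /curve_acceleration /curve_normal /curve_velocity /=.
apply: cvgD; apply: cvgM; [exact: cc1|exact: c2|exact: cc2|].
by apply: cvgN; exact: c1.
Qed.

(** The sign of the curvature is read off the analytic function Y'', which spares the analyticity of
    the products in [curvature]. *)
Lemma curvature_sign t : exists2 r : R, 0 < r & forall s, `|s| < r ->
  [/\ 0 < derive1 (derive1 (frame_y alpha i t)) s -> kappa (t + s) < 0,
      derive1 (derive1 (frame_y alpha i t)) s < 0 -> 0 < kappa (t + s) &
      derive1 (derive1 (frame_y alpha i t)) s = 0 -> kappa (t + s) = 0].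
Proof.
have [r r0 hr] := frame_x_steep hOmega halpha i t; exists r => // s sr.
have := frame_curvature hOmega halpha i t s; rewrite -/(kappa _).
have := hr s (ltW sr); set X' := derive1 _ _; set Y'' := derive1 _ _ => X'0 e.
have X'p : 0 < X' by lra.
split=> h.
- by have : kappa (t + s) * X' < 0 by [lra]; rewrite pmulr_llt0.
- by have : 0 < kappa (t + s) * X' by [lra]; rewrite pmulr_lgt0.
- have /eqP : kappa (t + s) * X' = 0 by lra.
  by rewrite mulf_eq0 (gt_eqF X'p) orbF => /eqP.
Qed.

Lemma curvature_sign_right t : exists2 d : R, 0 < d &
  (forall h, 0 < h < d -> 0 < kappa (t + h)) \/ (forall h, 0 < h < d -> kappa (t + h) <= 0).
Proof.
have [r r0 hr] := curvature_sign t.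
have [_ aY] := frame_analytic hOmega i t.
have [d d0 hd] := analytic_sign_right 0 (real_analytic_derive1 (real_analytic_derive1 aY)).
exists (Num.min d r); first by rewrite lt_min d0.
case: hd => hd; [right|left|right] => h; rewrite lt_min => /and3P[h0 h1 h2];
  have hn : `|h| = h by rewrite gtr0_norm.
- have [k _ _] := hr h ltac:(by rewrite hn); apply/ltW/k.
  by have := hd h; rewrite h0 h1 add0r; apply.
- have [_ k _] := hr h ltac:(by rewrite hn); apply: k.
  by have := hd h; rewrite h0 h1 add0r; apply.
- have [_ _ k] := hr h ltac:(by rewrite hn); rewrite k//.
  by have := hd h; rewrite hn add0r; apply.
Qed.

Lemma curvature_sign_left t : exists2 d : R, 0 < d &
  (forall h, 0 < h < d -> 0 < kappa (t - h)) \/ (forall h, 0 < h < d -> kappa (t - h) <= 0).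
Proof.
have [r r0 hr] := curvature_sign t.
have [_ aY] := frame_analytic hOmega i t.
have [d d0 hd] := analytic_sign_right 0
  (real_analytic_flip (real_analytic_derive1 (real_analytic_derive1 aY))).
exists (Num.min d r); first by rewrite lt_min d0.
case: hd => hd; [right|left|right] => h; rewrite lt_min => /and3P[h0 h1 h2];
  have hn : `|- h| = h by rewrite normrN gtr0_norm.
- have [k _ _] := hr (- h) ltac:(by rewrite hn); apply/ltW/k.
  by have := hd h; rewrite h0 h1 add0r; apply.
- have [_ k _] := hr (- h) ltac:(by rewrite hn); apply: k.
  by have := hd h; rewrite h0 h1 add0r; apply.
- have [_ _ k] := hr (- h) ltac:(by rewrite hn); rewrite k//.
  by have := hd h; rewrite -hn normrN normr_id add0r; apply; rewrite -normrN hn.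
Qed.

(** [inflection_boundary] quantifies existentially over decompositions, so a point can be shown to
    belong to it only once one has been exhibited. *)
Lemma concave_intervals_exist : exists (K : nat) (l r : 'I_K -> R),
  concave_intervals (a i) (b i) (alpha i) l r.
Proof.
have := positive_set_intervals (ltW (curve_domain hOmega i)) curvature_continuous
  curvature_sign_right curvature_sign_left.
move=> /interval_unionP[K [l [r [lr dis e]]]]; exists K, l, r; split=> //.
Qed.

(** [t] is a limit of points of positive curvature, so it lies in some [l j, r j]. If it were not
    the left end, points just before [t] would be in the closure as well, yet the curvature is
    nonpositive around them. *)
Lemma inflection_left_end t (d : R) : a i <= t < b i -> 0 < d ->
  (forall h, 0 < h < d -> 0 < kappa (t + h)) ->
  (forall h, 0 < h < d -> kappa (t - h) <= 0) ->
  inflection_boundary a b alpha (alpha i t).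
Proof.
move=> /andP[ati tb] d0 pos neg.
have [K [l [r cI]]] := concave_intervals_exist; have [lr dis e] := cI.
have : (\bigcup_j `[l j, r j]%classic) t.
  rewrite -e => B /nbhs_ballP[c /= c0 hB].
  pose m := Num.min (Num.min c d) (b i - t) / 2.
  have mm0 : 0 < Num.min (Num.min c d) (b i - t) by rewrite !lt_min c0 d0 subr_gt0.
  have : 0 < m < Num.min (Num.min c d) (b i - t) by rewrite /m; lra.
  rewrite !lt_min => /andP[m0 /andP[/andP[mc md] mb]].
  exists (t + m); split.
    split; last by apply: pos; rewrite m0.
    by rewrite in_itv /=; apply/andP; split; lra.
  by apply: hB; rewrite /ball /= opprD addrA subrr add0r normrN gtr0_norm.
move=> [j _]; rewrite /= in_itv /= => /andP[lt tr].
exists i, K, l, r, j; split=> //; left; congr (alpha i _).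
apply: le_anti; rewrite lt andbT leNgt; apply/negP => ltt.
pose m := Num.min d (t - l j) / 2.
have mm0 : 0 < Num.min d (t - l j) by rewrite lt_min d0 subr_gt0.
have : 0 < m < Num.min d (t - l j) by rewrite /m; lra.
rewrite lt_min => /and3P[m0 md ml].
have : (\bigcup_j `[l j, r j]%classic) (t - m).
  by exists j => //=; rewrite in_itv /=; apply/andP; split; lra.
rewrite -e => /(_ `]t - d, t[%classic)[].
  by apply: near_in_itvoo; rewrite in_itv /=; apply/andP; split; lra.
move=> u [[_ ku]]; rewrite /= in_itv /= => /andP[u1 u2].
have := neg (t - u); rewrite subKr => /(_ _); rewrite leNgt ku => h.
by have := h ltac:(lra).
Qed.

Lemma inflection_right_end t (d : R) : a i < t <= b i -> 0 < d ->
  (forall h, 0 < h < d -> 0 < kappa (t - h)) ->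
  (forall h, 0 < h < d -> kappa (t + h) <= 0) ->
  inflection_boundary a b alpha (alpha i t).
Proof.
move=> /andP[ati tb] d0 pos neg.
have [K [l [r cI]]] := concave_intervals_exist; have [lr dis e] := cI.
have : (\bigcup_j `[l j, r j]%classic) t.
  rewrite -e => B /nbhs_ballP[c /= c0 hB].
  pose m := Num.min (Num.min c d) (t - a i) / 2.
  have mm0 : 0 < Num.min (Num.min c d) (t - a i) by rewrite !lt_min c0 d0 subr_gt0.
  have : 0 < m < Num.min (Num.min c d) (t - a i) by rewrite /m; lra.
  rewrite !lt_min => /andP[m0 /andP[/andP[mc md] mb]].
  exists (t - m); split.
    split; last by apply: pos; rewrite m0.
    by rewrite in_itv /=; apply/andP; split; lra.
  by apply: hB; rewrite /ball /= opprB addrC subrK gtr0_norm.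
move=> [j _]; rewrite /= in_itv /= => /andP[lt tr].
exists i, K, l, r, j; split=> //; right; congr (alpha i _).
apply: le_anti; rewrite tr /= leNgt; apply/negP => ltt.
pose m := Num.min d (r j - t) / 2.
have mm0 : 0 < Num.min d (r j - t) by rewrite lt_min d0 subr_gt0.
have : 0 < m < Num.min d (r j - t) by rewrite /m; lra.
rewrite lt_min => /and3P[m0 md ml].
have : (\bigcup_j `[l j, r j]%classic) (t + m).
  by exists j => //=; rewrite in_itv /=; apply/andP; split; lra.
rewrite -e => /(_ `]t, t + d[%classic)[].
  by apply: near_in_itvoo; rewrite in_itv /=; apply/andP; split; lra.
move=> u [[_ ku]]; rewrite /= in_itv /= => /andP[u1 u2].
have := neg (u - t); rewrite (addrC t) subrK => /(_ _); rewrite leNgt ku => h.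
by have := h ltac:(lra).
Qed.

Lemma inflection_of_sign_change t (d : R) : a i <= t < b i -> 0 < d ->
  (forall h, 0 < h < d -> 0 < kappa (t + h)) /\ (forall h, 0 < h < d -> kappa (t - h) <= 0) \/
  (forall h, 0 < h < d -> 0 < kappa (t - h)) /\ (forall h, 0 < h < d -> kappa (t + h) <= 0) ->
  inflection_boundary a b alpha (alpha i t).
Proof.
move=> tr d0 [[pos neg]|[pos neg]]; first exact: (inflection_left_end tr d0).
move: tr => /andP[]; rewrite le_eqVlt => /predU1P[at' tb|at' tb]; last first.
  by apply: (inflection_right_end _ d0) => //; rewrite at' ltW.
(* The endpoint [a i] is the same boundary point as [b i]. *)
have -> : alpha i t = alpha i (b i).
  by rewrite -at' -(curve_periodic hOmega i (a i)) addrC subrK.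
have kb u : kappa (b i + u) = kappa (t + u).
  by rewrite -(curvature_periodic (t + u)) -at'; congr kappa; ring.
apply: (inflection_right_end _ d0); first by rewrite (curve_domain hOmega) lexx.
  by move=> h hd; rewrite kb; exact: pos.
by move=> h hd; rewrite kb; exact: neg.
Qed.

End Inflection.

(** * Exit times *)

Lemma derive1_flip {R : realType} (f : R -> R) : real_analytic f ->
  derive1 (fun t => f (- t)) = fun t => - derive1 f (- t).
Proof.
move=> fa; apply/funext => t; rewrite derive1E; apply: derive_val.
have h : is_derive (0 - t) 1 f (derive1 f (- t)).
  by rewrite sub0r; exact: real_analytic_is_derive.
have := is_derive_reflect h.
by rewrite (_ : (fun u => f (0 - u)) = fun u => f (- u))//; apply/funext => u; rewrite sub0r.
Qed.

(** The sign of f'' integrates twice from f 0 = f' 0 = 0. The identically zero case joins the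
    nonnegative one: a straight boundary piece does not let its tangent ray into the open domain. *)
Lemma second_derivative_sign {R : realType} (f : R -> R) :
  real_analytic f -> f 0 = 0 -> derive1 f 0 = 0 -> exists2 d : R, 0 < d &
  (forall h, 0 < h < d -> derive1 (derive1 f) h < 0 /\ f h < 0) \/
  (forall h, 0 < h < d -> 0 <= derive1 (derive1 f) h /\ 0 <= f h).
Proof.
move=> aF f0 f'0; have aF' := real_analytic_derive1 aF.
have dF x := real_analytic_is_derive x aF; have dF' x := real_analytic_is_derive x aF'.
have [d d0 sg] := analytic_sign_right 0 (real_analytic_derive1 aF').
pose neg := forall h, 0 < h < d -> derive1 (derive1 f) h < 0.
pose pos := forall h, 0 < h < d -> 0 <= derive1 (derive1 f) h.
have {sg}[sg|sg] : neg \/ pos.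
  case: sg => sg; [right|left|right] => h hh; have := sg h; rewrite add0r.
  - by move=> /(_ hh)/ltW.
  - exact.
  - by move: hh => /andP[h0 hd]; rewrite gtr0_norm// => ->.
- exists d => //; left=> h /andP[h0 hd]; split; first by apply: sg; rewrite h0.
  have f'neg x : 0 < x -> x < d -> derive1 f x < 0.
    move=> x0 xd; rewrite -f'0 -ltrN2.
    apply: (@derive_gt0_lt _ (fun x => - derive1 f x) (fun x => - derive1 (derive1 f) x)) => //.
    by move=> z /andP[z0 zx]; rewrite oppr_gt0; apply: sg; rewrite z0 (lt_trans zx).
  rewrite -f0 -ltrN2.
  apply: (@derive_gt0_lt _ (fun x => - f x) (fun x => - derive1 f x)) => //.
  by move=> z /andP[z0 zx]; rewrite oppr_gt0; apply: f'neg => //; exact: lt_trans hd.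
- exists d => //; right=> h /andP[h0 hd]; split; first by apply: sg; rewrite h0.
  have f'pos x : 0 < x -> x < d -> 0 <= derive1 f x.
    move=> x0 xd; rewrite -f'0.
    apply: (@derive_ge0_le _ (derive1 f) (derive1 (derive1 f))) => //; first exact: ltW.
    by move=> z /andP[z0 zx]; apply: sg; rewrite z0 (lt_trans zx).
  rewrite -f0; apply: (@derive_ge0_le _ f (derive1 f)) => //; first exact: ltW.
  by move=> z /andP[z0 zx]; apply: f'pos => //; exact: lt_trans hd.
Qed.

Section ExitTime.
Context {R : realType} (Omega : set (R * R)) (M : nat)
  (Om : 'I_M.+1 -> set (R * R)) (a b : 'I_M.+1 -> R)
  (alpha : 'I_M.+1 -> R -> R * R).
Hypothesis hOmega : analytic_nonconvex_domain Omega Om a b alpha.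
Hypothesis halpha : arclength_outward Omega a b alpha.
Implicit Types (x q v n : R * R).

Let oO : open Omega := domain_open hOmega.

Lemma domain_enorm_bound : exists B : R, forall y, Omega y -> enorm y <= B.
Proof.
have [C [_ hC]] := domain_bounded hOmega.
exists ((C + 1) + (C + 1)) => y Oy.
have : `|y| <= C + 1 by exact: (hC (C + 1) (ltr_pwDr ltr01 (lexx _)) y Oy).
rewrite [`|y|]/(Num.max `|y.1| `|y.2|) ge_max => /andP[y1 y2].
by apply: le_trans (enorm_le_sum y) _; exact: lerD.
Qed.

Definition exit_set x v : set R := [set s | 0 <= s /\ forall tau, 0 < tau < s -> Omega (x - tau *: v)].

Lemma exit_set_has_sup x v : v != 0 -> has_sup (exit_set x v).
Proof.
move=> v0; have [B hB] := domain_enorm_bound.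
have vp := enorm_gt0 v0; split.
  by exists 0; split=> // tau /andP[t0 t1]; have := lt_trans t0 t1; rewrite ltxx.
exists (Num.max 0 (2 * ((B + enorm x) / enorm v))) => s [].
move=> s0 hs; move: s0; rewrite [0 <= s]le_eqVlt => /predU1P[<-|s0]; first by rewrite le_max lexx.
rewrite le_max; apply/orP; right.
(* Membership is known only at times strictly before [s]; evaluating at s / 2 is the source of the
   factor 2 in the bound. *)
have /hB : Omega (x - (s / 2) *: v) by apply: hs; apply/andP; split; lra.
have := enormD_le (x - (x - (s / 2) *: v)) 0.
have := enormD_le x (- (x - (s / 2) *: v)).
rewrite enormN [x + _](_ : _ = (s / 2) *: v); last by rewrite opprD opprK addrA subrr add0r.
rewrite enormZ gtr0_norm ?divr_gt0// => h _ h2.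
rewrite -ler_pdivrMl// mulrC ler_pdivlMr//; lra.
Qed.

Lemma exit_time_inside x v tau : v != 0 -> 0 < tau < exit_time Omega x v ->
  Omega (x - tau *: v).
Proof.
move=> v0 /andP[t0 tT].
have [s [s0 hs] ts] := sup_adherent (eps := exit_time Omega x v - tau) ltac:(by rewrite subr_gt0) (exit_set_has_sup x v0).
by apply: hs; rewrite t0; move: ts; rewrite -/(exit_time Omega x v) subKr.
Qed.

Lemma exit_time_ge x v (d : R) : v != 0 -> 0 <= d ->
  (forall tau, 0 < tau < d -> Omega (x - tau *: v)) -> d <= exit_time Omega x v.
Proof.
by move=> v0 d0 h; apply: ub_le_sup; [exact: (exit_set_has_sup x v0).2|split].
Qed.

Lemma exit_time_boundary x v : v != 0 -> 0 < exit_time Omega x v ->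
  boundary Omega (x - exit_time Omega x v *: v).
Proof.
move=> v0 T0; set T := exit_time Omega x v in T0 *.
apply/(boundaryP _ oO); split.
  apply: (closure_ray (w := v) T0) => t /andP[t0 tT].
  rewrite -addrA -scaleNr -scalerDl (_ : - T + t = - (T - t)) ?scaleNr; last by ring.
  by apply: exit_time_inside => //; rewrite -/T; apply/andP; split; lra.
move=> /(open_enorm oO)[e e0 he].
have vp := enorm_gt0 v0.
pose m := e / enorm v; have m0 : 0 < m by rewrite divr_gt0.
have : T + m <= T; last by lra.
apply: exit_time_ge => //; first by lra.
move=> tau /andP[t0 tTm]; have [tT|Tt] := ltP tau T.
  by apply: exit_time_inside => //; rewrite t0.
apply: he; rewrite opprD opprK addrACA subrr add0r addrC -scalerBl enormZ.
rewrite distrC ger0_norm ?subr_ge0// -ltr_pdivlMr//; rewrite -/m; lra.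
Qed.

(** * Tangent rays on either side of a boundary point *)

Section Side.
Variables (i : 'I_M.+1) (t0 : R).
Let X := frame_x alpha i t0.
Let Y := frame_y alpha i t0.
Let T := curve_velocity (alpha i) t0.
Let q := alpha i t0.

(** [sg] selects the side, the left one being treated by flipping the parameter. Y < 0 means that
    the arc drops below its tangent, exactly where it is concave as seen from the domain. *)
Lemma side_sign (sg : R) : sg = 1 \/ sg = - 1 -> exists2 d : R, 0 < d &
  (forall h, 0 < h < d -> 0 < curvature (alpha i) (t0 + sg * h) /\ Y (sg * h) < 0) \/
  (forall h, 0 < h < d -> curvature (alpha i) (t0 + sg * h) <= 0 /\ 0 <= Y (sg * h)).
Proof.
move=> sgE; have [aX aY] := frame_analytic hOmega i t0.
have aY' := real_analytic_derive1 aY.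
have [_ Y0 _ Y'0] := frame_origin hOmega halpha i t0.
have [r r0 hr] := curvature_sign hOmega halpha i t0.
have [d d0 hd] : exists2 d : R, 0 < d &
  (forall h, 0 < h < d -> derive1 (derive1 Y) (sg * h) < 0 /\ Y (sg * h) < 0) \/
  (forall h, 0 < h < d -> 0 <= derive1 (derive1 Y) (sg * h) /\ 0 <= Y (sg * h)).
  case: sgE => ->.
    have [d d0 hd] := second_derivative_sign aY Y0 Y'0; exists d => //.
    by case: hd => hd; [left|right] => h hh; rewrite mul1r; exact: hd.
  have [|||d d0 hd] := @second_derivative_sign _ (fun t => Y (- t)).
  - exact: real_analytic_flip.
  - by rewrite oppr0.
  - by rewrite (derive1_flip aY) oppr0 Y'0 oppr0.
  have e h : derive1 (derive1 (fun t => Y (- t))) h = derive1 (derive1 Y) (- h).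
    rewrite (derive1_flip aY) derive1E; apply: derive_val.
    have hh : is_derive (0 - h) 1 (derive1 Y) (derive1 (derive1 Y) (- h)).
      by rewrite sub0r; exact: real_analytic_is_derive.
    have h1 : is_derive h 1 (fun u => derive1 Y (- u)) (- derive1 (derive1 Y) (- h)).
      have := is_derive_reflect hh.
      by rewrite (_ : (fun u => derive1 Y (0 - u)) = fun u => derive1 Y (- u))//; apply/funext => u; rewrite sub0r.
    by apply: (is_derive_eq (is_deriveN h1)); rewrite opprK.
  exists d => //; case: hd => hd; [left|right] => h hh; have := hd h hh;
    by rewrite mulN1r e.
exists (Num.min d r); first by rewrite lt_min d0.
case: hd => hd; [left|right] => h; rewrite lt_min => /and3P[h0 h1 h2];
  have [k1 k2] := hd h ltac:(by rewrite h0);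
  have [|c1 c2 c3] := hr (sg * h);
  try by case: sgE => ->; rewrite ?mul1r ?mulN1r ?normrN gtr0_norm.
- by split=> //; exact: c2.
- split=> //; move: k1; rewrite le_eqVlt => /predU1P[k1|k1].
    by rewrite (c3 _)// k1.
  exact/ltW/c1.
Qed.

Lemma side_onto (sg eta : R) : sg = 1 \/ sg = - 1 -> 0 < eta ->
  exists2 e : R, 0 < e & forall x : R, 0 < x < e -> exists2 h, 0 < h < eta & X (sg * h) = sg * x.
Proof.
move=> sgE eta0; have [r r0 hr] := frame_x_steep hOmega halpha i t0.
have [aX aY] := frame_analytic hOmega i t0; have [X0 _ _ _] := frame_origin hOmega halpha i t0.
have sg2 : sg * sg = 1 by case: sgE => ->; ring.
have m0 : 0 < Num.min eta r by rewrite lt_min eta0.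
have [e e0 he] := frame_x_onto hOmega halpha i t0 m0; exists e => // x /andP[x0 xe].
have [|s] := he (sg * x).
  by case: sgE => ->; rewrite ?mul1r ?mulN1r ?normrN gtr0_norm.
rewrite lt_min => /andP[seta sr] Xs; exists (sg * s); last by rewrite mulrA sg2 mul1r.
have Xle u w : - r <= u -> u <= w -> w <= r -> X u <= X w.
  move=> u1 uw w1; apply: (@derive_ge0_le _ X (derive1 X)) => //.
    by move=> z _; exact: real_analytic_is_derive.
  move=> z /andP[uz zw]; have : 1 / 2 < derive1 X z; last by lra.
  by apply: hr; rewrite ler_norml; apply/andP; split; lra.
move: seta sr; rewrite !ltr_norml => /andP[s1 s2] /andP[s3 s4].
have sgs : 0 < sg * s.
  rewrite ltNge; apply/negP => ssg.
  have X0' : X 0 = 0 := X0; have Xs' : X s = sg * x := Xs.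
  case: sgE ssg Xs' => ->; rewrite ?mul1r ?mulN1r => ssg Xs'.
    by have := Xle s 0; rewrite X0' Xs'; lra.
  by have := Xle 0 s; rewrite X0' Xs'; lra.
by rewrite sgs; case: sgE => ->; lra.
Qed.

Let n0T (c : R) : dot (curve_normal (alpha i) t0) (c *: T) = 0.
Proof. by rewrite dotZr /dot /curve_normal /T /=; ring. Qed.

Let unitT : enorm T = 1.
Proof. by have [] := curve_outward hOmega halpha i t0. Qed.

(** In the chart the tangent ray has ordinate 0, so [local_chart] compares it with the sign of Y on
    that side. *)
Lemma tangent_side (sg : R) : sg = 1 \/ sg = - 1 ->
  (exists2 d : R, 0 < d & (forall h, 0 < h < d -> 0 < curvature (alpha i) (t0 + sg * h)) /\
    forall x : R, 0 < x < d -> Omega (q + (sg * x) *: T)) \/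
  (exists2 d : R, 0 < d & (forall h, 0 < h < d -> curvature (alpha i) (t0 + sg * h) <= 0) /\
    forall x : R, 0 < x < d -> ~ Omega (q + (sg * x) *: T)).
Proof.
move=> sgE; have [d d0 hd] := side_sign sgE.
have [e e0 he] := local_chart hOmega halpha i t0.
have m0 : 0 < Num.min d e by rewrite lt_min d0.
have [c c0 hc] := side_onto sgE m0.
have chart (x : R) : 0 < x < Num.min c e -> exists2 h, 0 < h < d &
    (Y (sg * h) < 0 -> Omega (q + (sg * x) *: T)) /\
    (0 <= Y (sg * h) -> ~ Omega (q + (sg * x) *: T)).
  rewrite lt_min => /and3P[x0 xc xe].
  have [h] := hc x ltac:(by rewrite x0); rewrite lt_min => /and3P[h0 hd' he'] Xh.
  exists h; first by rewrite h0.
  have sgn y : 0 < y -> `|sg * y| = y.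
    by move=> y0; case: sgE => ->; rewrite ?mul1r ?mulN1r ?normrN gtr0_norm.
  have qq : q + (sg * x) *: T - q = (sg * x) *: T by rewrite addrAC subrr add0r.
  have [| | |k1 k2] := he (q + (sg * x) *: T) (sg * h).
  - by rewrite -/q qq enormZ unitT mulr1 sgn.
  - by rewrite sgn.
  - rewrite -/q qq -/X Xh dotZr -enorm_sqr -/T unitT expr1n mulr1//.
  move: k1 k2; rewrite -/q qq n0T oppr0 => k1 k2.
  (* If Y vanishes, the tangent point is itself on the arc and so outside the open set. *)
  split=> // Yh; move: (Yh); rewrite le_eqVlt => /predU1P[Yh0|/k2[]//].
  suff -> : q + (sg * x) *: T = alpha i (t0 + sg * h).
    exact/(boundary_outside hOmega)/(curve_boundary hOmega).
  apply: (subIr q); rewrite qq.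
  rewrite [RHS](frame_decomposition hOmega halpha i t0 (alpha i (t0 + sg * h) - q)).
  rewrite -/T -/(frame_x alpha i t0 _) -/X Xh.
  have -> : dot (curve_normal (alpha i) t0) (alpha i (t0 + sg * h) - q) = - Y (sg * h).
    by rewrite /Y /frame_y opprK.
  by rewrite -Yh0 oppr0 scale0r addr0.
case: hd => hd; [left|right]; (exists (Num.min d (Num.min c e));
  [by rewrite !lt_min d0 c0|split=> [h|x]; rewrite lt_min => /and3P[h0 h1 h2]]).
- by have [] := hd h ltac:(by rewrite h0).
- have [h hh [k1 _]] := chart x ltac:(by rewrite h0); apply: k1.
  by have [] := hd h hh.
- by have [] := hd h ltac:(by rewrite h0).
- have [h hh [_ k1]] := chart x ltac:(by rewrite h0); apply: k1.
  by have [] := hd h hh.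
Qed.

End Side.

Lemma enorm_specular_reflection n v : enorm n = 1 -> enorm (specular_reflection n v) = enorm v.
Proof.
move=> n1; have nn : dot n n = 1 by rewrite -enorm_sqr n1 expr1n.
rewrite /enorm; congr Num.sqrt.
move: nn; rewrite /specular_reflection /dot /= /GRing.scale /= => nn.
transitivity (v.1 * v.1 + v.2 * v.2 + 4 * (n.1 * v.1 + n.2 * v.2) ^+ 2 * (n.1 * n.1 + n.2 * n.2 - 1)).
  by ring.
by rewrite nn subrr mulr0 addr0.
Qed.

(* The only boundary points at which a ray grazing the boundary stops are
   those where the curvature changes sign. *)
Lemma reflected_ray_inside q v (d : R) : boundary Omega q -> v != 0 -> 0 < d ->
  (forall t, 0 < t < d -> Omega (q + t *: v)) ->
  ~ inflection_grazing_set Omega a b alpha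
      (q, specular_reflection (outward_normal Omega q) v) ->
  exists2 e : R, 0 < e & forall t, 0 < t < e ->
    Omega (q - t *: specular_reflection (outward_normal Omega q) v).
Proof.
move=> bq v0 d0 hd; set n := outward_normal Omega q; set v' := specular_reflection n v.
have hn : is_outward_normal Omega q n := boundary_normal hOmega halpha bq.
have nn : dot n n = 1 by rewrite -enorm_sqr hn.1 expr1n.
have nv' : dot n v' = - dot n v.
  rewrite /v' /specular_reflection dotDr dotNr dotZr nn; ring.
(* Time runs backward: the trajectory arrives at [q] along q + t v with t decreasing to 0, so [v]
   cannot point outward. *)
have nv : dot n v <= 0.
  rewrite leNgt; apply/negP => nv; have [e e0 he] := outward_normal_ray v hn.
  have m0 : 0 < Num.min d e by rewrite lt_min d0.
  have : 0 < Num.min d e / 2 < Num.min d e by lra.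
  rewrite lt_min => /and3P[t0 t1 t2].
  have /he[_ /(_ nv)] : 0 < Num.min d e / 2 < e by rewrite t0.
  by apply; apply: hd; rewrite t0.
move: nv; rewrite le_eqVlt => /predU1P[nv|nv] hI; last first.
  have [e e0 he] := outward_normal_ray (- v') hn; exists e => // t /he[h _].
  by rewrite -scalerN; apply: h; rewrite dotNr nv' opprK.
have v'E : v' = v by rewrite /v' /specular_reflection nv mulr0 scale0r subr0.
have [i [t [ti qt]]] := boundary_param hOmega bq.
have hT := curve_outward hOmega halpha i t.
set T := curve_velocity (alpha i) t in hT.
have nE : n = curve_normal (alpha i) t.
  by apply: outward_normalE; rewrite qt; exact: hT.2.
have vT : v = dot T v *: T.
  by rewrite [LHS](frame_decomposition hOmega halpha i t v) -nE nv scale0r addr0.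
pose c := dot T v.
have c0 : c != 0 by apply: contra_neq v0 => cz; rewrite vT -/c cz scale0r.
pose sg := Num.sg c.
have sgE : sg = 1 \/ sg = - 1.
  rewrite /sg; have [cp|cn|/eqP] := ltgtP 0 c; last by rewrite eq_sym (negPf c0).
    by left; exact: gtr0_sg.
  by right; exact: ltr0_sg.
have sgE' : - sg = 1 \/ - sg = - 1 by case: sgE => ->; [right|left; rewrite opprK].
have cE : c = sg * `|c| by rewrite -numEsg.
have cp : 0 < `|c| by rewrite normr_gt0.
(* Grazing case, with v' = v tangent. The side of arrival is in [Omega], so the curvature is
   positive there. *)
have [[d1 d10 [pos1 in1]]|[d1 d10 [neg1 out1]]] := tangent_side i t sgE; last first.
  exfalso; pose m := Num.min d (d1 / `|c|) / 2.
  have mm0 : 0 < Num.min d (d1 / `|c|) by rewrite lt_min d0 divr_gt0.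
  have : 0 < m < Num.min d (d1 / `|c|) by rewrite /m; lra.
  rewrite lt_min => /and3P[m0 md]; rewrite ltr_pdivlMr// => mc.
  apply: (out1 (m * `|c|)); first by rewrite mc mulr_gt0.
  rewrite -qt (_ : _ *: T = m *: v); first by apply: hd; rewrite m0.
  by rewrite {1}vT -/c {2}cE scalerA; congr (_ *: T); ring.
(* On the side of departure, positive curvature lets the ray go on inside; otherwise the curvature
   changes sign at [q], an excluded inflection point. *)
have [[d2 d20 [pos2 in2]]|[d2 d20 [neg2 out2]]] := tangent_side i t sgE'.
  exists (d2 / `|c|); first by rewrite divr_gt0.
  move=> u /andP[u0]; rewrite ltr_pdivlMr// => uc.
  have := in2 (u * `|c|); rewrite uc mulr_gt0// -qt v'E => /(_ isT).
  congr (Omega (_ + _)); rewrite {1}vT -/c {2}cE scalerA -scaleNr.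
  by congr (_ *: T); ring.
case: hI; split.
  by split=> //=; rewrite -/n -/v' v'E.
rewrite /= qt; apply: (inflection_of_sign_change hOmega halpha (d := Num.min d1 d2)) => //.
  by rewrite lt_min d10.
have p1 h : 0 < h < Num.min d1 d2 -> 0 < curvature (alpha i) (t + sg * h).
  by rewrite lt_min => /and3P[h0 h1 h2]; apply: pos1; rewrite h0.
have p2 h : 0 < h < Num.min d1 d2 -> curvature (alpha i) (t - sg * h) <= 0.
  by rewrite lt_min => /and3P[h0 h1 h2]; rewrite -mulNr; apply: neg2; rewrite h0.
case: sgE p1 p2 => -> p1 p2; [left|right]; split=> h /[dup] /p1 + /p2;
  by rewrite ?mul1r ?mulN1r ?opprK.
Qed.

(** The segment just travelled shows that the next bounce is reached from inside, which is what
    [reflected_ray_inside] needs to start the next segment. *)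
Lemma cycle_exit_time_gt0 x v : v != 0 -> 0 < exit_time Omega x v ->
  (forall k, ~ inflection_grazing_set Omega a b alpha (specular_cycle Omega x v k)) ->
  forall k, enorm (specular_cycle Omega x v k).2 = enorm v /\
    0 < exit_time Omega (specular_cycle Omega x v k).1 (specular_cycle Omega x v k).2.
Proof.
move=> v0 T0 hI; elim=> [//|k [vk Tk]].
have := hI k.+1; rewrite /specular_cycle iterS -/(specular_cycle Omega x v k).
move: vk Tk; case: (specular_cycle Omega x v k) => xk w /= wv Tk.
have w0 : w != 0.
  apply: contraTneq (enorm_gt0 v0) => w0; rewrite -wv w0 -leNgt.
  by rewrite -(scale0r (0 : R * R)) enormZ normr0 mul0r.
rewrite /specular_step /=; set T := exit_time Omega xk w in Tk *; set q := xk - T *: w => hq.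
have bq : boundary Omega q by exact: exit_time_boundary.
have hn : is_outward_normal Omega q (outward_normal Omega q) := boundary_normal hOmega halpha bq.
rewrite enorm_specular_reflection; last exact: hn.1.
split=> //; have [|e e0 he] := reflected_ray_inside bq w0 Tk _ hq.
  move=> t /andP[t0 tT].
  rewrite /q -addrA -scaleNr -scalerDl (_ : - T + t = - (T - t)) ?scaleNr; last by ring.
  by apply: exit_time_inside => //; rewrite -/T; apply/andP; split; lra.
apply: (lt_le_trans e0); apply: exit_time_ge => //; last exact: ltW.
rewrite -(enorm_specular_reflection w hn.1) in wv.
apply: contraTneq (enorm_gt0 v0) => w'0; rewrite -wv w'0 -leNgt.
by rewrite -(scale0r (0 : R * R)) enormZ normr0 mul0r.
Qed.

End ExitTime.

(** Near the limit both tangents and chords are almost horizontal, so reflection cannot reverse the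
    horizontal direction. The parameters are then monotone and, tending to 0, stay on one side of
    it. The last hypothesis is in slope form so as to cover both directions of motion. *)
Lemma no_vanishing_billiard {R : realType} (X Y : R -> R) :
  real_analytic X -> real_analytic Y ->
  (forall x, derive1 X x ^+ 2 + derive1 Y x ^+ 2 = 1) -> derive1 X 0 = 1 ->
  exists2 r : R, 0 < r & forall (s : nat -> R) (d : nat -> R * R),
  (forall i, `|s i| <= r) ->
  (forall e, 0 < e -> exists N, forall n, (N <= n)%N -> `|s n| < e) ->
  (forall i, dot (d i) (d i) = 1) ->
  (forall i, exists2 T : R, 0 < T &
     X (s i.+1) - X (s i) = T * (d i).1 /\ Y (s i.+1) - Y (s i) = T * (d i).2) ->
  (forall i, let c := derive1 X (s i.+1) * (d i).1 + derive1 Y (s i.+1) * (d i).2 in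
     (d i.+1).1 = 2 * c * derive1 X (s i.+1) - (d i).1 /\
     (d i.+1).2 = 2 * c * derive1 Y (s i.+1) - (d i).2) ->
  (forall i x, s i < x < s i.+1 \/ s i.+1 < x < s i ->
     Y x < Y (s i) + (X x - X (s i)) / (d i).1 * (d i).2) -> False.
Proof.
move=> aX aY unit X'0.
have aX' := real_analytic_derive1 aX; have aY' := real_analytic_derive1 aY.
have Y'0 : derive1 Y 0 = 0.
  by apply/eqP; rewrite -sqrf_eq0; have := unit 0; rewrite X'0; lra.
have dX x := real_analytic_is_derive x aX; have dY x := real_analytic_is_derive x aY.
(* The mirror image in the vertical axis, again a unit-speed curve with horizontal tangent at 0; it
   turns leftward motion into rightward motion. *)
pose Xm x := - X (- x); pose Ym x := Y (- x).
have aXm : real_analytic Xm.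
  have := real_analytic_lincomb (- 1) 0 (real_analytic_flip aX) (real_analytic_cst 0).
  by congr real_analytic; apply/funext => x; rewrite /Xm; ring.
have aYm : real_analytic Ym by exact: real_analytic_flip.
have dXm : derive1 Xm = fun x => derive1 X (- x).
  apply/funext => x; rewrite derive1E; apply: derive_val.
  have h : is_derive x 1 (fun u => X (- u)) (- derive1 X (- x)).
    have := real_analytic_is_derive x (real_analytic_flip aX); by rewrite (derive1_flip aX).
  by apply: (is_derive_eq (is_deriveN h)); rewrite opprK.
have dYm : derive1 Ym = fun x => - derive1 Y (- x) by exact: derive1_flip.
have unitm x : derive1 Xm x ^+ 2 + derive1 Ym x ^+ 2 = 1 by rewrite dXm dYm sqrrN.
have [r1 r10 h1] := no_bounded_billiard aX aY unit X'0.
have [r2 r20 h2] := no_bounded_billiard aXm aYm unitm ltac:(by rewrite dXm oppr0).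
have [r3 r30 hX] := continuous_dist (real_analytic_continuous aX' (x := 0)) (divr_gt0 ltr01 (ltr0Sn R 1)).
have [r4 r40 hY] := continuous_dist (real_analytic_continuous aY' (x := 0)) (divr_gt0 ltr01 (ltr0Sn R 3)).
pose r := Num.min (Num.min r1 r2) (Num.min r3 r4) / 2.
have m0 : 0 < Num.min (Num.min r1 r2) (Num.min r3 r4) by rewrite !lt_min r10 r20 r30.
have r0 : 0 < r by rewrite divr_gt0.
have : r < Num.min (Num.min r1 r2) (Num.min r3 r4) by rewrite /r; lra.
rewrite !lt_min => /andP[/andP[rr1 rr2] /andP[rr3 rr4]].
have X'r x : `|x| <= r -> 1 / 2 < derive1 X x.
  move=> xr; have /hX : `|x| < r3 by exact: le_lt_trans rr3.
  by rewrite add0r X'0 ltr_norml => /andP[? _]; lra.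
have Y'r x : `|x| <= r -> `|derive1 Y x| < 1 / 4.
  move=> xr; have /hY : `|x| < r4 by exact: le_lt_trans rr4.
  by rewrite add0r Y'0 subr0.
exists r => // s d sr s0 dunit chord refl below.
have between x y z : `|x| <= r -> `|y| <= r -> x < z < y -> `|z| <= r.
  by rewrite !ler_norml; lra.
(* |Y'| < 1/4 and X' > 1/2 give |Y'| < X' / 2, so chords have slope at most 1/2. *)
have mono x y : `|x| <= r -> `|y| <= r -> x <= y -> `|Y y - Y x| <= (X y - X x) / 2 .
  move=> xr yr xy.
  have slope (c : R) : `|c| = 1 -> X x / 2 - c * Y x <= X y / 2 - c * Y y.
    move=> c1; apply: (@derive_ge0_le _ (fun x => X x / 2 - c * Y x)
      (fun x => derive1 X x / 2 - c * derive1 Y x)) => //.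
      move=> z _; have ? := dX z; have ? := dY z.
      by apply: is_derive_eq; rewrite /GRing.scale /=; ring.
    move=> z xzy; have zr := between x y z xr yr xzy.
    have : c * derive1 Y z <= `|derive1 Y z|.
      by apply: le_trans (ler_norm _) _; rewrite normrM c1 mul1r.
    by have := X'r z zr; have := Y'r z zr; lra.
  have := slope 1 (normr1 _); have := slope (-1) (normrN1 _).
  by rewrite ler_norml; lra.
have Xle x y : `|x| <= r -> `|y| <= r -> x <= y -> X x <= X y.
  by move=> xr yr xy; have := mono x y xr yr xy; have := normr_ge0 (Y y - Y x); lra.
have dslope i : `|(d i).2| <= `|(d i).1| / 2.
  have [T T0 [TX TY]] := chord i.
  rewrite -(ler_pM2l T0) mulrA -(gtr0_norm T0) -!normrM -TX -TY.
  have [ss|/ltW ss] := leP (s i) (s i.+1).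
    apply: le_trans (mono _ _ (sr i) (sr i.+1) ss) _.
    by have := ler_norm (X (s i.+1) - X (s i)); lra.
  rewrite distrC; apply: le_trans (mono _ _ (sr i.+1) (sr i) ss) _.
  by rewrite distrC; have := ler_norm (X (s i) - X (s i.+1)); lra.
have d1n0 i : (d i).1 != 0.
  apply/negP => /eqP d10; have := dslope i; rewrite d10 normr0 mul0r normr_le0 => /eqP d20.
  by have := dunit i; rewrite /dot d10 d20; lra.
(* The product is (2 X'^2 - 1) d1^2 + 2 X' Y' d1 d2; the first term is at least 7/8 d1^2 and the
   second at most 1/4 d1^2 in absolute value. *)
have dsign i : 0 < (d i).1 * (d i.+1).1.
  have [-> _] := refl i; set X' := derive1 X _; set Y' := derive1 Y _.
  have u : X' ^+ 2 + Y' ^+ 2 = 1 := unit _.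
  have X'1 : 1 / 2 < X' := X'r _ (sr i.+1).
  have Y'1 : `|Y'| < 1 / 4 := Y'r _ (sr i.+1).
  have sl := dslope i; have n0 := d1n0 i.
  set d1 := (d i).1 in sl n0 *; set d2 := (d i).2 in sl *.
  have Y'2 : Y' ^+ 2 <= 1 / 16.
    by rewrite -real_normK ?num_real//; have := normr_ge0 Y'; nra.
  have X'le : X' <= 1 by have := sqr_ge0 Y'; nra.
  have d1p : 0 < d1 ^+ 2 by rewrite exprn_even_gt0.
  have dd : `|d1 * d2| <= d1 ^+ 2 / 2.
    rewrite normrM -[d1 ^+ 2]real_normK ?num_real// expr2 -mulrA ler_wpM2l//.
  have P : `|2 * X' * Y' * (d1 * d2)| <= d1 ^+ 2 / 4.
    rewrite normrM (_ : d1 ^+ 2 / 4 = 1 / 2 * (d1 ^+ 2 / 2)); last by field.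
    apply: ler_pM => //; rewrite !normrM gtr0_norm// gtr0_norm//; last by lra.
    have := normr_ge0 Y'; nra.
  have -> : d1 * (2 * (X' * d1 + Y' * d2) * X' - d1) =
     (2 * X' ^+ 2 - 1) * d1 ^+ 2 + 2 * X' * Y' * (d1 * d2) by ring.
  rewrite (_ : X' ^+ 2 = 1 - Y' ^+ 2); last by lra.
  by move: P; rewrite ler_norml => /andP[P _]; nra.
have dd_sign (c : R) i : 0 < c * (d 0%N).1 -> 0 < c * (d i).1.
  move=> c0; elim: i => // i IH.
  have := mulr_gt0 IH (dsign i).
  rewrite (_ : _ * _ * _ = c * (d i.+1).1 * (d i).1 ^+ 2); last by ring.
  have d2 : 0 < (d i).1 ^+ 2 by rewrite exprn_even_gt0 //= d1n0.
  by rewrite pmulr_lgt0.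
have [d0|d0|/eqP d0] := ltgtP 0 (d 0%N).1; last by move: (d1n0 0%N); rewrite eq_sym d0.
- have dp i : 0 < (d i).1 by have := dd_sign 1 i; rewrite !mul1r; apply.
  have slt i : s i < s i.+1.
    rewrite ltNge; apply/negP => /(Xle _ _ (sr i.+1) (sr i)).
    have [T T0 [TX _]] := chord i; have := mulr_gt0 T0 (dp i); lra.
  have sle i n : (i <= n)%N -> s i <= s n.
    elim: n => [|n IH]; first by rewrite leqn0 => /eqP->.
    rewrite leq_eqVlt => /predU1P[->//|]; rewrite ltnS => /IH h.
    by apply: le_trans h (ltW (slt n)).
  apply: (h1 s d) => // [i|i|i x sx].
  + have /andP[si1 _] : - r <= s i <= r by rewrite -ler_norml.
    apply/andP; split; first by lra.
    (* A positive [s i] would bound all later parameters away from 0. *)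
    rewrite leNgt; apply/negP => sp; have [n0 hn] := s0 _ sp.
    have := hn (maxn n0 i) (leq_maxl _ _); rewrite ltNge => /negP; apply.
    by apply: le_trans (ler_norm _); apply: sle; exact: leq_maxr.
  + by have [_ e] := refl i.
  + have := below i x (or_introl sx); rewrite -(ltr_pM2l (dp i)).
    rewrite (_ : (d i).1 * (Y (s i) + _) = (d i).1 * Y (s i) + (X x - X (s i)) * (d i).2).
      by lra.
    by field; exact: d1n0.
- have dp i : (d i).1 < 0 by have := dd_sign (-1) i; rewrite !mulN1r !oppr_gt0; apply.
  have slt i : s i.+1 < s i.
    rewrite ltNge; apply/negP => /(Xle _ _ (sr i) (sr i.+1)).
    have [T T0 [TX _]] := chord i; have : T * (d i).1 < 0 by rewrite pmulr_rlt0.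
    lra.
  have sle i n : (i <= n)%N -> s n <= s i.
    elim: n => [|n IH]; first by rewrite leqn0 => /eqP->.
    rewrite leq_eqVlt => /predU1P[->//|]; rewrite ltnS => /IH h.
    by apply: le_trans (ltW (slt n)) h.
  apply: (h2 (fun i => - s i) (fun i => (- (d i).1, (d i).2))) => /= [i|i|i|i|i|i x].
  + have /andP[_ si1] : - r <= s i <= r by rewrite -ler_norml.
    apply/andP; split; first by lra.
    rewrite oppr_le0 leNgt; apply/negP => sp.
    have [n0 hn] := s0 (- s i) ltac:(by rewrite oppr_gt0).
    have := hn (maxn n0 i) (leq_maxl _ _); rewrite ltNge => /negP; apply.
    rewrite -normrN; apply: le_trans (ler_norm _); rewrite lerN2.
    by apply: sle; exact: leq_maxr.
  + by rewrite ltrN2.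
  + by have := dunit i; rewrite /dot /= mulrNN oppr_gt0.
  + have [T T0 [TX TY]] := chord i; exists T => //; rewrite /Xm /Ym !opprK; lra.
  + by have [_ ->] := refl i; rewrite dXm dYm !opprK; ring.
  + move=> sx; have sx' : s i.+1 < - x < s i by lra.
    have := below i (- x) (or_intror sx').
    have dpn : 0 < - (d i).1 by rewrite oppr_gt0.
    rewrite -(ltr_pM2l dpn).
    rewrite (_ : - (d i).1 * (Y (s i) + _) = - (d i).1 * Y (s i) - (X (- x) - X (s i)) * (d i).2).
      by rewrite /Xm /Ym !opprK; lra.
    by field; exact: d1n0.
Qed.

(** * Trajectories of finite length *)

(** Each coordinate is a telescoping series dominated by the step lengths, hence convergent. *)
Lemma finite_length_cvg {R : realType} (xs : nat -> R * R) :
  (\sum_(0 <= i <oo) (enorm (xs i - xs i.+1))%:E)%E <> +oo%E ->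
  exists p : R * R, forall e : R, 0 < e ->
    exists N, forall n, (N <= n)%N -> enorm (xs n - p) < e.
Proof.
move=> fin; pose g i := enorm (xs i - xs i.+1).
have g0 i : 0 <= g i by exact: enorm_ge0.
have sg : cvgn (series g).
  have S0 : (0 <= \sum_(0 <= i <oo) (g i)%:E)%E by apply: nneseries_ge0 => i _ _; rewrite lee_fin.
  have Sf : (\sum_(0 <= i <oo) (g i)%:E)%E \is a fin_num.
    by rewrite ge0_fin_numE// ltey; apply/eqP.
  apply: nondecreasing_is_cvgn.
    by apply/nondecreasing_seqP => n; rewrite /series /= big_nat_recr//= lerDl.
  exists (fine (\sum_(0 <= i <oo) (g i)%:E)%E) => _ [n _ <-].
  rewrite -lee_fin fineK// /series /= -sumEFin.
  by apply: nneseries_lim_ge => i _ _; rewrite lee_fin.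
have coord (u : nat -> R) : (forall i, `|u i.+1 - u i| <= g i) -> cvgn u.
  move=> ug.
  have cs : cvgn (series (fun i => u i.+1 - u i)).
    apply: normed_cvg; apply: (series_le_cvg _ g0 _ sg) => i; [exact: normr_ge0|exact: ug].
  have -> : u = (fun n => series (fun i => u i.+1 - u i) n + u 0%N).
    by apply/funext => n; rewrite /series /= telescope_sumr// subrK.
  by apply: is_cvgD => //; exact: is_cvg_cst.
have c1 : cvgn (fun i => (xs i).1).
  by apply: coord => i; rewrite distrC; exact: norm_fst_le_enorm (xs i - xs i.+1).
have c2 : cvgn (fun i => (xs i).2).
  by apply: coord => i; rewrite distrC; exact: norm_snd_le_enorm (xs i - xs i.+1).
exists (limn (fun i => (xs i).1), limn (fun i => (xs i).2)) => e e0.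
have e2 : 0 < e / 2 by rewrite divr_gt0.
have /cvgr_distC_lt l1 := c1; have /cvgr_distC_lt l2 := c2.
have [N1 _ h1] := l1 _ e2; have [N2 _ h2] := l2 _ e2.
exists (maxn N1 N2) => n; rewrite geq_max => /andP[n1 n2].
apply: le_lt_trans (enorm_le_sum _) _.
by have := h1 n n1; have := h2 n n2; rewrite /=; lra.
Qed.

Section SpecularCycle.
Context {R : realType} (Omega : set (R * R)) (M : nat)
  (Om : 'I_M.+1 -> set (R * R)) (a b : 'I_M.+1 -> R)
  (alpha : 'I_M.+1 -> R -> R * R).
Hypothesis hOmega : analytic_nonconvex_domain Omega Om a b alpha.
Hypothesis halpha : arclength_outward Omega a b alpha.

Let oO : open Omega := domain_open hOmega.

Lemma boundary_limit (xs : nat -> R * R) (p : R * R) :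
  (forall n, boundary Omega (xs n)) ->
  (forall e : R, 0 < e -> exists N, forall n, (N <= n)%N -> enorm (xs n - p) < e) ->
  boundary Omega p.
Proof.
move=> bx hp; apply/(boundaryP _ oO); split.
  apply/closure_enormP => e e0; have e2 : 0 < e / 2 by rewrite divr_gt0.
  have [N hN] := hp _ e2; have [/closure_enormP cl _] := (boundaryP (xs N) oO).1 (bx N).
  have [y Oy yx] := cl _ e2; exists y => //.
  have := enormD_le (y - xs N) (xs N - p); rewrite addrA subrK.
  by have := hN N (leqnn _); lra.
move=> /(open_enorm oO)[e e0 he]; have [N hN] := hp e e0.
by apply: (boundary_outside hOmega (bx N)); apply: he; exact: hN.
Qed.

(** The tail of the trajectory is read in the chart at its limit point, where
    [no_vanishing_billiard] applies. *)
Lemma billiard_diverges (xs vs : nat -> R * R) (V : R) (tb : nat -> R) :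
  0 < V -> (forall n, enorm (vs n) = V) -> (forall n, 0 < tb n) ->
  (forall n, boundary Omega (xs n)) ->
  (forall n, xs n.+1 = xs n - tb n *: vs n) ->
  (forall n, vs n.+1 = specular_reflection (outward_normal Omega (xs n.+1)) (vs n)) ->
  (forall n t, 0 < t < tb n -> Omega (xs n - t *: vs n)) ->
  ~ (exists p : R * R, forall e : R, 0 < e ->
       exists N, forall n, (N <= n)%N -> enorm (xs n - p) < e).
Proof.
move=> V0 vV tb0 bx xS vS inside [p hp].
have bp := boundary_limit bx hp.
have [i [t0 [_ pE]]] := boundary_param hOmega bp.
pose X := frame_x alpha i t0; pose Y := frame_y alpha i t0.
pose T := curve_velocity (alpha i) t0; pose n0 := curve_normal (alpha i) t0.
have [aX aY] := frame_analytic hOmega i t0.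
have [_ _ X'0 _] := frame_origin hOmega halpha i t0.
have [r1 r10 main] := no_vanishing_billiard aX aY (frame_unit hOmega halpha i t0) X'0.
have [r2 r20 steep] := frame_x_steep hOmega halpha i t0.
have [e1 e10 chart] := local_chart hOmega halpha i t0.
rewrite -pE in chart.
have Xlt x y : `|x| <= r2 -> `|y| <= r2 -> x < y -> X x < X y.
  rewrite !ler_norml => xr yr xy; apply: (@derive_gt0_lt _ X (derive1 X)) => //.
    by move=> z _; exact: real_analytic_is_derive.
  move=> z xzy; have : 1 / 2 < derive1 X z; last by lra.
  by apply: steep; rewrite ler_norml; lra.
pose eta := Num.min (Num.min r1 r2) e1.
have eta0 : 0 < eta by rewrite !lt_min r10 r20.
have [eta1 eta2 eta3] : [/\ eta <= r1, eta <= r2 & eta <= e1].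
  by rewrite /eta !ge_min !lexx !orbT.
have [e2 e20 bchart] := boundary_chart hOmega halpha i t0 eta0.
rewrite -pE in bchart.
(* With bounces within a third of the radius, a chord is shorter than two thirds, so all its points
   stay in the chart. *)
have m0 : 0 < Num.min e1 e2 / 3 by rewrite divr_gt0// lt_min e10.
have [K hK] := hp _ m0.
have near n : enorm (xs (K + n)%N - p) < Num.min e1 e2 / 3 by apply: hK; exact: leq_addr.
have lem : Num.min e1 e2 <= e1 /\ Num.min e1 e2 <= e2 by rewrite !ge_min !lexx orbT.
have /choice[s hs] n : exists s, `|s| < eta /\ xs (K + n)%N = alpha i (t0 + s).
  have [|s se xe] := bchart _ (bx (K + n)%N); last by exists s.
  by have := near n; lra.
(* The motion is along - v; in the frame (T, - n0) its unit direction has these components. *)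
pose d n := (- dot T (vs (K + n)%N) / V, dot n0 (vs (K + n)%N) / V).
have Vn0 : V != 0 by rewrite gt_eqF.
have Xs n : dot T (xs (K + n)%N - p) = X (s n) by have [_ ->] := hs n; rewrite pE.
have Ys n : - dot n0 (xs (K + n)%N - p) = Y (s n) by have [_ ->] := hs n; rewrite pE.
have xSn n : xs (K + n.+1)%N - p = (xs (K + n)%N - p) - tb (K + n)%N *: vs (K + n)%N.
  by rewrite addnS xS addrAC.
have dunit n : dot (d n) (d n) = 1.
  have vv : V ^+ 2 = dot T (vs (K + n)%N) ^+ 2 + dot n0 (vs (K + n)%N) ^+ 2.
    rewrite -(vV (K + n)%N) enorm_sqr.
    rewrite {2}(frame_decomposition hOmega halpha i t0 (vs (K + n)%N)) -/T -/n0.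
    by rewrite dotDr !dotZr ![dot (vs _) _]dotC !expr2.
  rewrite /d; move: vv; set A := dot T _; set B := dot n0 _ => vv; rewrite /dot /=.
  transitivity ((A ^+ 2 + B ^+ 2) / V ^+ 2); first by field.
  by rewrite -vv divff// expf_neq0.
have dchord n : exists2 t : R, 0 < t &
   X (s n.+1) - X (s n) = t * (d n).1 /\ Y (s n.+1) - Y (s n) = t * (d n).2.
  exists (tb (K + n)%N * V); first by rewrite mulr_gt0.
  rewrite -!Xs -!Ys xSn !dotDr !dotNr !dotZr /d /=; split; field; exact: Vn0.
apply: (main s d) => //.
- by move=> n; apply: le_trans (ltW (hs n).1) eta1.
- move=> e e0; have me0 : 0 < Num.min e eta by rewrite lt_min e0.
  have [e3 e30 bc] := boundary_chart hOmega halpha i t0 me0; rewrite -pE in bc.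
  have [N hN] := hp _ e30; exists N => n Nn.
  have [|s'] := bc _ (bx (K + n)%N); first by apply: hN; exact: leq_trans Nn (leq_addl _ _).
  rewrite lt_min => /andP[s'e s'eta] xe.
  (* A smaller chart gives a small parameter for the same point; it is [s n] because X is injective
     on [- r2, r2]. *)
  suff -> : s n = s' by [].
  have XX : X (s n) = X s' by rewrite -Xs xe pE.
  have sr : `|s n| <= r2 := le_trans (ltW (hs n).1) eta2.
  have s'r : `|s'| <= r2 := le_trans (ltW s'eta) eta2.
  have [ss|ss|//] := ltgtP (s n) s'.
    by have := Xlt _ _ sr s'r ss; rewrite XX ltxx.
  by have := Xlt _ _ s'r sr ss; rewrite XX ltxx.
- move=> n c; have [nT nN] := frame_normal hOmega i t0 (s n.+1).
  have nE : outward_normal Omega (xs (K + n.+1)%N) = curve_normal (alpha i) (t0 + s n.+1).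
    by rewrite (hs n.+1).2; apply: outward_normalE; exact: (curve_outward hOmega halpha i _).2.
  have unit := frame_unit hOmega halpha i t0 (s n.+1).
  have vE : vs (K + n.+1)%N = specular_reflection (curve_normal (alpha i) (t0 + s n.+1)) (vs (K + n)%N).
    by rewrite -nE addnS -vS.
  move: nT nN vE; set nu := curve_normal _ (t0 + s n.+1); set v := vs (K + n)%N => nT nN vE.
  have nv : dot nu v = derive1 Y (s n.+1) * dot T v + derive1 X (s n.+1) * dot n0 v.
    rewrite {1}(frame_decomposition hOmega halpha i t0 v) dotDr !dotZr -/T -/n0.
    by rewrite !(dotC nu) nT nN; ring.
  rewrite /d /= vE /specular_reflection !dotDr !dotNr !dotZr nv nT nN /c /d /= -/v.
  move: unit; rewrite -/X -/Y; set X' := derive1 X _; set Y' := derive1 Y _ => unit.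
  set Tv := dot T v; set Nv := dot n0 v.
  have u0 : X' ^+ 2 + Y' ^+ 2 - 1 = 0 by rewrite unit subrr.
  split.
    (* The two sides agree only modulo the unit-speed relation, so a multiple of X'^2 + Y'^2 - 1 is
       added. *)
    transitivity (2 * (X' * (- Tv / V) + Y' * (Nv / V)) * X' - - Tv / V
      + 2 * (X' ^+ 2 + Y' ^+ 2 - 1) * Tv / V); first by field.
    by rewrite u0; ring.
  transitivity (2 * (X' * (- Tv / V) + Y' * (Nv / V)) * Y' - Nv / V
    - 2 * (X' ^+ 2 + Y' ^+ 2 - 1) * Nv / V); first by field.
  by rewrite u0; ring.
- move=> n x hx; rewrite -/X -/Y.
  set D := X x - X (s n); pose E := X (s n.+1) - X (s n).
  have sr m : `|s m| <= r2 := le_trans (ltW (hs m).1) eta2.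
  have [xr xe1] : `|x| <= r2 /\ `|x| < e1.
    have := (hs n).1; have := (hs n.+1).1; rewrite !ltr_norml ler_norml => ? ?.
    by split; [case: hx|case: hx]; lra.
  (* The point of the chord above parameter [x] is reached at the fraction [lam] of the flight,
     strictly between the two bounces. *)
  have [lam /andP[l0 l1] DE] : exists2 lam, 0 < lam < 1 & D = lam * E.
    have [[DE0 DE1]|[DE0 DE1]] : (0 < D /\ D < E) \/ (E < D /\ D < 0).
      case: hx => /andP[x1 x2]; [left|right]; rewrite /D /E.
        by have := Xlt _ _ (sr n) xr x1; have := Xlt _ _ xr (sr n.+1) x2; lra.
      by have := Xlt _ _ (sr n.+1) xr x1; have := Xlt _ _ xr (sr n) x2; lra.
    - have E0 : 0 < E by lra.
      exists (D / E); last by rewrite divfK// gt_eqF.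
      by rewrite divr_gt0//= ltr_pdivrMr// mul1r.
    - have E0 : E < 0 by lra.
      exists (D / E); last by rewrite divfK// lt_eqF.
      by rewrite ltr_ndivrMr// mul1r DE0 andbT nmulr_rgt0// invr_lt0.
  pose tn := tb (K + n)%N; pose v := vs (K + n)%N.
  pose q := xs (K + n)%N - (lam * tn) *: v.
  have tn0 : 0 < tn := tb0 _.
  have Oq : Omega q by apply: inside; rewrite mulr_gt0//= gtr_pMl.
  have qp : q - p = (xs (K + n)%N - p) - (lam * tn) *: v by rewrite /q addrAC.
  have ETv : E = - (tn * dot T v).
    by rewrite /E -!Xs xSn dotDr dotNr dotZr -/tn -/v; ring.
  have Tv0 : dot T v != 0.
    apply/eqP => Tv0; move: DE; rewrite ETv Tv0 mulr0 oppr0 mulr0 /D => XX.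
    have [x1|x1] : s n < x \/ x < s n by case: hx => /andP[]; [left|right].
      by have := Xlt _ _ (sr n) xr x1; lra.
    by have := Xlt _ _ xr (sr n) x1; lra.
  have qx : X x = dot T (q - p).
    rewrite qp dotDr dotNr dotZr Xs.
    by have : X x - X (s n) = lam * E := DE; rewrite ETv; lra.
  have qy : - dot n0 (q - p) = Y (s n) + D / (d n).1 * (d n).2.
    rewrite qp dotDr dotNr dotZr opprD opprK Ys DE ETv /d /= -/v.
    by field; rewrite Tv0 Vn0.
  have qe : enorm (q - p) < e1.
    have tV : tn * V < 2 * (Num.min e1 e2 / 3).
      have -> : tn * V = enorm ((xs (K + n)%N - p) - (xs (K + n.+1)%N - p)).
        by rewrite xSn opprD addrA subrr add0r opprK enormZ vV gtr0_norm.
      by apply: le_lt_trans (enormD_le _ _) _; rewrite enormN; have := near n; have := near n.+1; lra.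
    rewrite qp; apply: le_lt_trans (enormD_le _ _) _.
    rewrite enormN enormZ vV gtr0_norm ?mulr_gt0//.
    have : lam * tn * V < tn * V by rewrite ltr_pM2r// gtr_pMl.
    by have := near n; lra.
  (* Being in [Omega], [q] is not below the arc; equal ordinates would make it an arc point, hence
     outside [Omega]. *)
  have [_ above] := chart q x qe xe1 qx.
  rewrite -qy lt_neqAle; apply/andP; split; last first.
    by rewrite leNgt; apply/negP => /above[].
  apply/eqP => Yx; apply: (boundary_outside hOmega (curve_boundary hOmega i (t0 + x))).
  suff -> : alpha i (t0 + x) = q by [].
  apply: (subIr p); rewrite [RHS](frame_decomposition hOmega halpha i t0 (q - p)).
  rewrite [LHS](frame_decomposition hOmega halpha i t0 (alpha i (t0 + x) - p)) -/T -/n0 -qx.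
  by rewrite -[dot n0 (q - p)]opprK -Yx /X /Y /frame_x /frame_y opprK pE.
Qed.

End SpecularCycle.


Theorem lemma2 (R : realType) (Omega : set (R * R)) (M : nat)
  (Om : 'I_M.+1 -> set (R * R)) (a b : 'I_M.+1 -> R)
  (alpha : 'I_M.+1 -> R -> R * R) (N : R) (x v : R * R)
  (hOmega : analytic_nonconvex_domain Omega Om a b alpha)
  (halpha : arclength_outward Omega a b alpha)
  (hN : 1 < N)
  (hx : closure Omega x)
  (hv : velocity_shell N v)
  (hv0 : v != 0)
  (ht : 0 < exit_time Omega x v)
  (hI : forall i : nat,
    ~ inflection_grazing_set Omega a b alpha (specular_cycle Omega x v i)) :
  (\sum_(0 <= i <oo) (enorm ((specular_cycle Omega x v i).1
                             - (specular_cycle Omega x v i.+1).1))%:E = +oo)%E.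
Proof.
apply: contrapT => /finite_length_cvg[p hp].
have Vp := enorm_gt0 hv0.
have cyc := cycle_exit_time_gt0 hOmega halpha hv0 ht hI.
pose c k := specular_cycle Omega x v k.
have cS k : c k.+1 = specular_step Omega (c k) by [].
have c0 k : (c k).2 != 0.
  apply: contraTneq Vp => w0; rewrite -(cyc k).1 -/(c k) w0 -leNgt.
  by rewrite -(scale0r (0 : R * R)) enormZ normr0 mul0r.
pose tb k := exit_time Omega (c k.+1).1 (c k.+1).2.
(* The cycle is taken from index 1 on, since the starting point [x] may be interior. *)
apply: (@billiard_diverges _ _ _ _ _ _ _ hOmega halpha (fun k => (c k.+1).1)
  (fun k => (c k.+1).2) (enorm v) tb Vp).
- by move=> k; have [] := cyc k.+1.
- by move=> k; have [] := cyc k.+1.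
- move=> k; rewrite cS /specular_step /=.
  by apply: (exit_time_boundary hOmega) (c0 k) _; have [] := cyc k.
- by [].
- by [].
- by move=> k t; apply: (exit_time_inside hOmega); exact: c0.
- exists p => e /hp[k0 hk]; exists k0 => n kn; apply: hk; exact: leqW.
Qed.
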